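(* Let $\alpha\in[0,n)$, $p,q\in[1,\infty)$, $\lambda\in[-n/p,0)$, $\mu\in[-n/q,0)$, $u\in(0,\infty]$, $\Theta\in\Theta_*$, and let $$w(r)=r^{-\sigma}\Theta(r^{\tau}),\qquad \sigma,\tau\in(0,\infty)\ \text{with}\ \sigma>\tau.$$ Assume that $\mu=\lambda+\alpha$, $q\le(\lambda/\mu)p$ and $\sigma+\lambda+\alpha\le0$. Then the operator $M_\alpha$ is bounded from $B_w^u(L_{p,\lambda})(\mathbb R^n)$ to $B_w^u(L_{q,\mu})(\mathbb R^n)$ if $p\in(1,\infty)$, and from $B_w^u(L_{1,\lambda})(\mathbb R^n)$ to $B_w^u(WL_{q,\mu})(\mathbb R^n)$ if $p=1$. The same conclusion holds with $\dot B_w^u$ in place of $B_w^u$.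
   Context: For $r>0$, $Q_r\subset\mathbb R^n$ is the open cube $\{y:\max_i|y_i|<r\}$ (for all $r$), or the open ball $\{y:|y|<r\}$ (for all $r$); $Q(x,s)=x+Q_s$. For $U=\mathbb R^n$ or $U=Q_r$, the Morrey space $L_{p,\lambda}(U)$ and weak Morrey space $WL_{p,\lambda}(U)$ consist of all $f$ with finite $$\|f\|_{L_{p,\lambda}(U)}=\sup_{Q(x,s)\subset U}\frac1{s^\lambda}\Big(\frac1{|Q(x,s)|}\int_{Q(x,s)}|f|^p\Big)^{1/p},\quad \|f\|_{WL_{p,\lambda}(U)}=\sup_{Q(x,s)\subset U}\frac1{s^\lambda}\Big(\frac{\sup_{t>0}t^p|\{y\in Q(x,s):|f(y)|>t\}|}{|Q(x,s)|}\Big)^{1/p}.$$ For $E$ any of these types of spaces, $w:(0,\infty)\to(0,\infty)$ and $u\in(0,\infty]$, $B_w^u(E)(\mathbb R^n)$ and $\dot B_w^u(E)(\mathbb R^n)$ are the sets of measurable $f$ on $\mathbb R^n$ with $f|_{Q_r}\in E(Q_r)$ for all $r>0$ and, respectively, $\|f\|_{B_w^u(E)}=\big\|w(r)\|f\|_{E(Q_r)}\big\|_{L^u([1,\infty),dr/r)}<\infty$, $\|f\|_{\dot B_w^u(E)}=\big\|w(r)\|f\|_{E(Q_r)}\big\|_{L^u((0,\infty),dr/r)}<\infty$. $\Theta_*$ is the set of functions $\Theta:(0,\infty)\to(0,\infty)$ such that for some $C\in(0,\infty)$ and $\epsilon,\epsilon'\in(0,1)$, $\Theta(tr)/\Theta(r)\le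 C\max(t^{\epsilon},t^{\epsilon'})$ for all $r,t>0$. The fractional maximal operator is $M_\alpha f(x)=\sup_{Q\ni x}|Q|^{-1+\alpha/n}\int_Q|f(y)|\,dy$, the supremum over all cubes (or balls) $Q$ containing $x$ ($\alpha=0$: Hardy–Littlewood maximal operator). *)

(* Defs.v *)
From HB Require Import structures.
From mathcomp Require Import all_boot all_order all_algebra.
From mathcomp Require Import all_classical all_reals all_analysis.
From mathcomp Require Import measurable_realfun.

Set Implicit Arguments.
Unset Strict Implicit.
Unset Printing Implicit Defensive.
Import Order.TTheory GRing.Theory Num.Theory.
Import numFieldNormedType.Exports.

Local Open Scope classical_set_scope.
Local Open Scope ring_scope.
Local Open Scope ereal_scope.

Section lebesgue_outer_measure.
Context {R : realType} {n : nat}.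

(* [Some (a, b)] encodes the half-open box \prod_i ]a_i, b_i], and [None] the
   empty set; [None] only matters for n = 0, where every box is nonempty. *)
Definition box (c : option ('rV[R]_n * 'rV[R]_n)) : set 'rV[R]_n :=
  if c is Some (a, b) then
    [set x | forall i, (a ord0 i < x ord0 i <= b ord0 i)%R]
  else set0.

Definition box_volume (c : option ('rV[R]_n * 'rV[R]_n)) : \bar R :=
  if c is Some (a, b) then
    (\prod_(i < n) Num.max 0 (b ord0 i - a ord0 i))%R%:E
  else 0.

Definition box_cover (X : set 'rV[R]_n) :
    set (nat -> option ('rV[R]_n * 'rV[R]_n)) :=
  [set F | X `<=` \bigcup_k box (F k)].

Definition lebesgue_outer (X : set 'rV[R]_n) : \bar R :=
  ereal_inf [set \sum_(k <oo) box_volume (F k) | F in box_cover X].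

Lemma box_volume_ge0 c : 0 <= box_volume c.
Proof.
case: c => [[a b]|//]; rewrite lee_fin; apply: prodr_ge0 => i _.
by rewrite le_max lexx.
Qed.

Lemma le_lebesgue_outer : {homo lebesgue_outer : A B / A `<=` B >-> A <= B}.
Proof.
move=> A B AB; apply/ereal_inf_le_tmp => x [F BF <-{x}].
by exists F => //; exact: subset_trans AB BF.
Qed.

Lemma lebesgue_outer_ge0 A : 0 <= lebesgue_outer A.
Proof.
apply: le_ereal_inf_tmp => x [F _ <-{x}].
by apply: nneseries_ge0 => k _ _; exact: box_volume_ge0.
Qed.

Lemma lebesgue_outer0 : lebesgue_outer set0 = 0.
Proof.
apply/eqP; rewrite eq_le lebesgue_outer_ge0 andbT.
apply: ereal_inf_lbound; exists (fun=> None); first by [].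
by apply: eseries0.
Qed.

Lemma lebesgue_outer_sigma_subadditive : sigma_subadditive lebesgue_outer.
Proof.
move=> A; have [[i ioo]|] := pselect (exists i, lebesgue_outer (A i) = +oo).
  rewrite (eseries_pinfty _ _ ioo) ?leey// => k _.
  by rewrite -ltNye (lt_le_trans _ (lebesgue_outer_ge0 _)).
rewrite -forallNE => Aoo.
suff add2e (e : {posnum R}) : lebesgue_outer (\bigcup_n A n) <=
    \sum_(i <oo) lebesgue_outer (A i) + e%:num%:E.
  by apply/lee_addgt0Pr => _/posnumP[].
rewrite (le_trans _ (epsilon_trick _ _ _))//; last first.
  by move=> k; exact: lebesgue_outer_ge0.
pose P k F := box_cover (A k) F /\
  \sum_(j <oo) box_volume (F j) <=
  lebesgue_outer (A k) + (e%:num / (2 ^ k.+1)%:R)%:E.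
have [G PG] : {G & forall k, P k (G k)}.
  apply: (@choice _ _ P) => k; rewrite /P /lebesgue_outer.
  set S := (X in ereal_inf X); move infS : (ereal_inf S) => iS.
  case: iS infS => [r Sr|Soo|Soo].
  - have en1 : (0 < e%:num / (2 ^ k.+1)%:R)%R by [].
    have /(lb_ereal_inf_adherent en1) : ereal_inf S \is a fin_num by rewrite Sr.
    move=> [x [B AB muBx] xS].
    by exists B; split => //; rewrite muBx -Sr; exact/ltW.
  - by have := Aoo k; rewrite /lebesgue_outer Soo.
  - suff : lbound S 0 by move/le_ereal_inf_tmp; rewrite Soo.
    move=> /= _ [B AB <-].
    by apply: nneseries_ge0 => j _ _; exact: box_volume_ge0.
have vG_ge0 x : 0 <= (box_volume \o uncurry G) x by exact: box_volume_ge0.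
apply: (@le_trans _ _ (\esum_(i in setT) (box_volume \o uncurry G) i)).
  apply: ereal_inf_lbound => /=.
  have /card_esym/ppcard_eqP[f] := card_nat2.
  exists (uncurry G \o f).
    move=> t [i _ /(PG i).1[j _ Gijt]]; exists (f^-1%FUN (i, j)) => //=.
    by rewrite invK ?inE.
  rewrite -(esum_pred_image (box_volume \o uncurry G) _ xpredT) ?[fun=> _]set_true//.
  by rewrite image_eq.
rewrite (_ : esum _ _ =
    \sum_(i <oo) \sum_(j <oo ) box_volume (G i j)); last first.
  pose J : nat -> set (nat * nat) := fun i => [set (i, j) | j in setT].
  rewrite (_ : setT = \bigcup_k J k); last first.
    by rewrite predeqE => -[a b]; split => // _; exists a => //; exists b.
  rewrite esum_bigcupT /=; last 2 first.
    - apply/trivIsetP => i j _ _ ij.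
      rewrite predeqE => -[k m] /=; split => //= -[] [_] _ [<-{k} _].
      by move=> [m' _] [] /esym/eqP; rewrite (negbTE ij).
    - by move=> /= [k m]; exact: box_volume_ge0.
  rewrite -(image_id [set: nat]) -fun_true esum_pred_image//; last first.
    by move=> k _; apply: esum_ge0 => -[? ?] _; exact: box_volume_ge0.
  apply: eq_eseriesr => /= j _.
  rewrite -(esum_pred_image (box_volume \o uncurry G) (pair j) predT)/=.
  - by congr esum; rewrite predeqE => -[a b]; split; move=> [i _ <-]; exists i.
  - by move=> k _; exact: box_volume_ge0.
  - by move=> ? ? _ _; exact: (@can_inj _ _ _ snd).
apply: lee_lim.
- apply: is_cvg_nneseries => k *.
  by apply: nneseries_ge0 => m *; exact: (vG_ge0 (k, m)).
- apply: is_cvg_nneseries => k *.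
  by apply: adde_ge0 => //; exact: lebesgue_outer_ge0.
- by near=> k; apply: lee_sum => i _; exact: (PG i).2.
Unshelve. all: by end_near. Qed.

HB.instance Definition _ := isOuterMeasure.Build R 'rV[R]_n lebesgue_outer
  lebesgue_outer0 lebesgue_outer_ge0 le_lebesgue_outer
  lebesgue_outer_sigma_subadditive.

End lebesgue_outer_measure.

Definition lebesgue_outer_measure (R : realType) (n : nat) :
  {outer_measure set 'rV[R]_n -> \bar R} := @lebesgue_outer R n.

(* R^n equipped with the sigma-algebra of Lebesgue measurable sets. *)
Notation Rn R n := (caratheodory_type (lebesgue_outer_measure R n)).

Definition lebesgue (R : realType) (n : nat) :
  {measure set (Rn R n) -> \bar R} := lebesgue_outer_measure R n.

(* dr/r on (0, oo), the Haar measure of the multiplicative group. *)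

Section haar_measure.
Context {R : realType}.

Definition haar (A : set (measurableTypeR R)) : \bar R :=
  \int[lebesgue_measure]_(r in A `&` `]0%R, +oo[) (r^-1)%:E.

Let haar0 : haar set0 = 0.
Proof. by rewrite /haar set0I integral_set0. Qed.

Let haar_ge0 A : 0 <= haar A.
Proof.
apply: integral_ge0 => r [_] /=; rewrite in_itv/= andbT => r0.
by rewrite lee_fin invr_ge0 ltW.
Qed.

Let haar_sigma_additive : semi_sigma_additive haar.
Proof.
move=> F mF tF _; rewrite /haar setI_bigcupl ge0_integral_bigcup//=.
- by apply: is_cvg_ereal_nneg_natsum_cond => k _ _; exact: haar_ge0.
- by move=> k; apply: measurableI => //; exact: (@measurable_itv R).
- apply/measurable_EFinP.
  apply: (@measurable_funS _ _ _ _ (`]0%R, +oo[ : set R)).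
  - exact: (@measurable_itv R).
  - by move=> r [k _ []].
  apply: open_continuous_measurable_fun; first exact: interval_open.
  move=> r; rewrite inE/= in_itv/= andbT => r0.
  by apply: inv_continuous; rewrite gt_eqF.
- move=> r [k _ [_]] /=; rewrite in_itv/= andbT => r0.
  by rewrite lee_fin invr_ge0 ltW.
- exact: trivIset_setIr.
Qed.

HB.instance Definition _ := isMeasure.Build _ (measurableTypeR R) R haar
  haar0 haar_ge0 haar_sigma_additive.

End haar_measure.

Variant cube_or_ball := Cube | Ball.

Section function_spaces.
Context {R : realType} {n : nat}.
Implicit Types (k : cube_or_ball) (x : 'rV[R]_n) (r s p lam : R).
Implicit Types (U : set 'rV[R]_n) (f : Rn R n -> \bar R).

(* The norm of the normed module 'rV[R]_n is the max norm. *)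
Definition Q0 k r : set 'rV[R]_n :=
  match k with
  | Cube => [set y : 'rV[R]_n | (`|y| < r)%R]
  | Ball => [set y : 'rV[R]_n |
              (Num.sqrt (\sum_(i < n) (y ord0 i) ^+ 2) < r)%R]
  end.

Definition Q k x s : set 'rV[R]_n := [set y | Q0 k s (y - x)%R].

(* Functions take values in [-oo, +oo], so that M_alpha f is one of them. *)
Definition morrey_norm k p lam U f : \bar R :=
  ereal_sup [set z | exists x s, [/\ (0 < s)%R, Q k x s `<=` U &
    z = ((s `^ lam)^-1)%R%:E *
        ((\int[lebesgue R n]_(y in Q k x s) (`|f y| `^ p))
          / lebesgue R n (Q k x s)) `^ p^-1]].

Definition weak_morrey_norm k p lam U f : \bar R :=
  ereal_sup [set z | exists x s, [/\ (0 < s)%R, Q k x s `<=` U &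
    z = ((s `^ lam)^-1)%R%:E *
        (ereal_sup [set (t `^ p)%R%:E *
                        lebesgue R n (Q k x s `&` [set y | t%:E < `|f y|])
                   | t in [set t : R | (0 < t)%R]]
          / lebesgue R n (Q k x s)) `^ p^-1]].

(* [E] is the norm f |-> ||f||_E(U) of a family of spaces E(U), each made of
   the functions of finite norm; [I] is the range of r, namely [1, oo) for
   B_w^u(E) and (0, oo) for the homogeneous variant. *)
Definition BI_norm (I : interval R) k (w : R -> R) (u : \bar R)
    (E : set 'rV[R]_n -> (Rn R n -> \bar R) -> \bar R) f : \bar R :=
  Lnorm (mrestr haar (measurable_itv I)) u (fun r => (w r)%:E * E (Q0 k r) f).

Definition BI_space I k w u E : set (Rn R n -> \bar R) :=
  [set f | [/\ measurable_fun setT f,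
               forall r, (0 < r)%R -> E (Q0 k r) f < +oo &
               BI_norm I k w u E f < +oo]].

Definition B_norm := BI_norm `[1%R, +oo[.
Definition B_space := BI_space `[1%R, +oo[.
Definition Bdot_norm := BI_norm `]0%R, +oo[.
Definition Bdot_space := BI_space `]0%R, +oo[.

Definition frac_maximal k (alpha : R) f (x : Rn R n) : \bar R :=
  ereal_sup [set z | exists y s, [/\ (0 < s)%R, Q k y s x &
    z = (lebesgue R n (Q k y s)) `^ (- 1 + alpha / n%:R)%R *
        \int[lebesgue R n]_(v in Q k y s) `|f v|]].

Definition bounded_operator (T : (Rn R n -> \bar R) -> (Rn R n -> \bar R))
    (X : set (Rn R n -> \bar R)) (normX : (Rn R n -> \bar R) -> \bar R)
    (Y : set (Rn R n -> \bar R)) (normY : (Rn R n -> \bar R) -> \bar R) :=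
  exists C : R, (0 < C)%R /\
    forall f, X f -> Y (T f) /\ normY (T f) <= C%:E * normX f.

End function_spaces.

Definition Theta_star {R : realType} (Theta : R -> R) : Prop :=
  (forall r : R, 0 < r -> 0 < Theta r)%R /\
  exists C eps eps' : R,
    [/\ (0 < C)%R, (0 < eps < 1)%R, (0 < eps' < 1)%R &
        forall r t : R, (0 < r -> 0 < t ->
          Theta (t * r) / Theta r <= C * Num.max (t `^ eps) (t `^ eps'))%R].

(* Main.v *)
Require Import Defs.
From HB Require Import structures.
From mathcomp Require Import all_boot all_order all_algebra.
From mathcomp Require Import all_classical all_reals all_analysis.
From mathcomp Require Import measurable_realfun ess_sup_inf.
From mathcomp Require Import ring lra.

Set Implicit Arguments.
Unset Strict Implicit.
Unset Printing Implicit Defensive.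
Import Order.TTheory GRing.Theory Num.Theory.
Import numFieldNormedType.Exports.

(** Write [N r] for the norm of [f] in [L_{p,lam}(Q_r)], a nondecreasing
    function of [r], and [theta = mu / lam], so that [0 < theta <= 1] and
    [q theta <= p].

    The heart of the proof is a local estimate, [morrey_frac_maximal] for
    [p > 1] and [weak_morrey_frac_maximal] for [p = 1]: with [c = 4 n^2] and a
    constant [C] independent of [f], [r] and [K], if [N (c r t) <= t^(-mu) K]
    for all [t >= 1], then the norm of [M_alpha f] on [Q_r] in the target Morrey
    (or weak Morrey) space is at most [C K].  To prove it, fix [Q(x,s)] inside
    [Q_r], a point [y] of it and a cube or ball of radius [rho] containing [y].
    If [rho >= s], the assumption bounds [rho^alpha] times the mean by [C s^mu K].
    If [rho < s], the mean [a] of [|f|] over the enclosing cube is at most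
    [C rho^lam K] by the assumption, and if [a] is also at most [v s^lam K] for
    some [v >= 1], then interpolating the two bounds with the exponent [theta]
    (the trick of Hedberg) gives [rho^alpha a <= C v^theta s^mu K], the powers
    of [rho] having cancelled.  Hence the points of [Q(x,s)] at which
    [M_alpha f] exceeds [C v^theta s^mu K] lie in the set where the
    Hardy-Littlewood maximal function of the restriction of [f] to the cube of
    radius [3 s] centred at [x] exceeds [v s^lam K] ([frac_maximal_superlevel]).
    The measure of that set is controlled by the weak type (1,1) inequality
    [weak_type11], which gives the case [p = 1] directly; for [p > 1] one sums
    over [v = 2^j] with the help of the strong type inequality [strong_type].

    The weak type inequality comes from the covering lemma of Vitali, applied to
    finite families of cubes with rational centres and radii, and the strong
    type inequality from the usual truncation of [f] at the height of the level
    set.  Both need little of Lebesgue measure: that open sets are measurable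
    and that cubes and balls of radius [r] have measure [v r^n] with
    [0 < v < oo].

    It remains to integrate in [r].  The smallest admissible [K] at [r] is at
    most [H r = sup_j 2^(mu j) N (a_j r)], where [a_j = 2 c 2^j].  Since
    [sigma + mu <= 0] and [Theta] is in [Theta_star], the weight satisfies
    [2^(mu j) w r <= C rho^j w (a_j r)] for some [rho < 1] ([weight_dilation]),
    so that [w r H r <= C sup_j rho^j (w N)(a_j r)].  The measure [dr/r] is
    invariant under dilations, so each term on the right has an [L^u] norm at
    most [rho^j] times that of [w N]; for finite [u] the [u]-th power of the
    supremum is at most the sum of the [u]-th powers, and the resulting
    geometric series converges whatever [u > 0] is ([Lnorm_dilation_sup]).

    A function of the class [Theta_star] may fail to be measurable, in which
    case the integral defining the norm is a lower integral, monotone but not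
    additive.  The estimates are therefore carried out on a measurable function
    [G <= w N] comparable to [w N], built from the least nondecreasing majorant
    of [Theta] ([measurable_minorant]), and brought back to [w N] by
    monotonicity alone ([le_Lnorm_haar]). *)

(** * Cubes and balls *)

Section cubes.
Local Open Scope classical_set_scope.
Local Open Scope ring_scope.
Context {R : realType} {n : nat}.
Implicit Types (x y : 'rV[R]_n) (r s : R).

Lemma mx_norm_ltP x r : 0 < r -> (`|x| < r <-> forall i, `|x ord0 i| < r).
Proof.
move=> r0; rewrite /Num.norm/= mx_normrE; split=> [xr i|xr].
  apply: le_lt_trans xr.
  by apply/bigmax_geP; right; exists (ord0, i).
by apply/bigmax_ltP; split => // -[i j] _ /=; rewrite ord1 xr.
Qed.

Lemma sub_cubeP x y r : 0 < r ->
  Q Cube y r x <-> forall i, y ord0 i - r < x ord0 i < y ord0 i + r.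
Proof.
move=> r0; rewrite /Q/= mx_norm_ltP//; split=> h i; have := h i; rewrite !mxE.
  by rewrite ltr_distl.
by rewrite ltr_distl.
Qed.

Lemma coord_le_mx_norm x i : `|x ord0 i| <= `|x|.
Proof.
by rewrite [leRHS]/Num.norm/= mx_normrE; apply/bigmax_geP; right; exists (ord0, i).
Qed.

Lemma Q_sub_cube k x r : Q k x r `<=` Q Cube x r.
Proof.
case: k => //= y; rewrite /Q/= => yr.
have r0 : 0 < r by apply: le_lt_trans yr; exact: sqrtr_ge0.
apply/(mx_norm_ltP _ r0) => i; apply: le_lt_trans yr.
rewrite -sqrtr_sqr ler_wsqrtr// (bigD1 i)//= lerDl.
by apply: sumr_ge0 => j _; exact: sqr_ge0.
Qed.

Lemma cube_sub_Q k x r : (0 < n)%N -> Q Cube x r `<=` Q k x (n%:R * r).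
Proof.
move=> n0 y; rewrite /Q/= => yr.
have r0 : 0 < r by apply: le_lt_trans yr.
have rnr : r <= n%:R * r by rewrite ler_peMl ?ler1n// ltW.
case: k; first exact: lt_le_trans yr _.
rewrite /= -(ltr_pXn2r (ltn0Sn 1)) ?nnegrE ?sqrtr_ge0 ?mulr_ge0// ?ltW//.
rewrite sqr_sqrtr ?sumr_ge0// => [|i _]; last exact: sqr_ge0.
apply: (@lt_le_trans _ _ (\sum_(i < n) r ^+ 2)).
  apply: ltr_sum => //.
    by apply/hasP; exists (Ordinal n0) => //; rewrite mem_index_enum.
  move=> i _; rewrite -[ltLHS]real_normK ?num_real// ltr_pXn2r// ?nnegrE ?(ltW r0)//.
  exact: le_lt_trans (coord_le_mx_norm _ _) yr.
rewrite sumr_const card_ord exprMn -[leLHS]mulr_natl ler_wpM2r ?sqr_ge0//.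
by rewrite expr2 ler_peMl// ler1n.
Qed.

Lemma open_Q k x r : open (Q k x r).
Proof.
case: k; rewrite /Q/=.
  rewrite (_ : [set _ | _] = ball x r); first exact: ball_open.
  by apply/seteqP; split => y; rewrite -ball_normE /ball_/= distrC.
pose f := fun y : 'rV[R]_n => Num.sqrt (\sum_(i < n) (y ord0 i - x ord0 i) ^+ 2).
have cf : continuous f.
  move=> y; apply: (@continuous_comp _ _ _
     (fun y : 'rV[R]_n => \sum_(i < n) (y ord0 i - x ord0 i) ^+ 2) Num.sqrt);
       last exact: sqrt_continuous.
  move: y; apply: continuous_big; first exact: add_continuous.
  move=> i _ y.
  apply: (@continuous_comp _ _ _ (fun y : 'rV[R]_n => y ord0 i)
    (fun u => (u - x ord0 i) ^+ 2)); first exact: coord_continuous.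
  apply: (@continuous_comp _ _ _ (fun u => u - x ord0 i) (fun u => u ^+ 2)).
    by apply: cvgB; [exact: cvg_id|exact: cvg_cst].
  exact: exprn_continuous.
rewrite (_ : [set _ | _] = f @^-1` [set u | u < r]); last first.
  by apply/seteqP; split => y /=; rewrite /f; under eq_bigr do rewrite !mxE.
by apply: open_comp => [y _|]; [exact: cf|exact: open_lt].
Qed.

Lemma Q_center k x r : 0 < r -> Q k x r x.
Proof.
move=> r0; rewrite /Q/= subrr; case: k => /=; first by rewrite normr0.
by rewrite big1 ?sqrtr0// => i _; rewrite mxE expr0n.
Qed.

Lemma Q0E k r : Q0 k r = Q k 0 r :> set 'rV[R]_n.
Proof. by apply/seteqP; split => y; rewrite /Q/= subr0. Qed.

Lemma Q_scale k x r : 0 < r ->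
  Q k x r = (fun y => x + r *: y) @` Q k 0 1.
Proof.
move=> r0; apply/seteqP; split => [y|_ [y + <-]]; last first.
  rewrite /Q/= subr0 (addrC x) addrK; case: k => /=.
    by rewrite mx_normZ gtr0_norm// gtr_pMr.
  move=> y1; under eq_bigr do rewrite mxE exprMn.
  by rewrite -mulr_sumr sqrtrM ?sqr_ge0// sqrtr_sqr gtr0_norm// gtr_pMr.
move=> Qy; exists (r^-1 *: (y - x)); last first.
  by rewrite scalerA divff ?gt_eqF// scale1r addrC subrK.
move: Qy; rewrite /Q/= subr0; case: k => /=.
  by rewrite mx_normZ gtr0_norm ?invr_gt0// mulrC ltr_pdivrMr// mul1r.
move=> y1; under eq_bigr do rewrite mxE exprMn.
rewrite -mulr_sumr sqrtrM ?sqr_ge0// sqrtr_sqr gtr0_norm ?invr_gt0//.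
by rewrite mulrC ltr_pdivrMr// mul1r.
Qed.

Lemma Q0_mono k r s : r <= s -> (Q0 k r : set 'rV[R]_n) `<=` Q0 k s.
Proof. by move=> rs; case: k => y /= h; exact: lt_le_trans h rs. Qed.

End cubes.

(** * Lebesgue measure of cubes and balls *)

Section lebesgue_geometry.
Local Open Scope classical_set_scope.
Local Open Scope ring_scope.
Local Open Scope ereal_scope.
Context {R : realType} {n : nat}.
Implicit Types (x y : 'rV[R]_n) (r s : R) (A U : set 'rV[R]_n).

(** An affine map sends a cover by boxes to a cover by boxes. *)
Lemma le_lebesgue_outer_scale x r A : (0 < r)%R ->
  lebesgue_outer ((fun y => x + r *: y)%R @` A) <= (r ^+ n)%:E * lebesgue_outer A.
Proof.
move=> r0; have rn0 : (0 < r ^+ n)%R by rewrite exprn_gt0.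
rewrite -lee_pdivrMl//; apply: le_ereal_inf_tmp => _ [F AF <-].
rewrite lee_pdivrMl//.
pose G i := if F i is Some (a, b) then Some (x + r *: a, x + r *: b)%R else None.
have -> : (r ^+ n)%:E * \sum_(k <oo) box_volume (F k) =
          \sum_(k <oo) box_volume (G k).
  rewrite -nneseriesZl; last by move=> i _; exact: box_volume_ge0.
  apply: eq_eseriesr => i _; rewrite /G; case: (F i) => [[a b]|]/=; last by rewrite mule0.
  rewrite -EFinM; congr (_%:E).
  have -> : (r ^+ n = \prod_(j < n) r)%R by rewrite prodr_const card_ord.
  rewrite -big_split/=; apply: eq_bigr => j _; rewrite !mxE.
  rewrite maxr_pMr ?(ltW r0)// mulr0; congr (Num.max _ _); lra.
apply: ereal_inf_lbound; exists G => //= _ [y Ay <-].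
have [i _ Fi] := AF y Ay; exists i => //; move: Fi; rewrite /box/= /G.
case: (F i) => [[a b]|]//= h j; rewrite !mxE ltrD2l lerD2l ltr_pM2l// ler_pM2l//.
Qed.

Lemma lebesgue_outer_scale x r A : (0 < r)%R ->
  lebesgue_outer ((fun y => x + r *: y)%R @` A) = (r ^+ n)%:E * lebesgue_outer A.
Proof.
move=> r0; apply/eqP; rewrite eq_le le_lebesgue_outer_scale//=.
have rn0 : (0 < r ^+ n)%R by rewrite exprn_gt0.
rewrite -lee_pdivlMl// -exprVn.
have := @le_lebesgue_outer_scale (- (r^-1 *: x))%R r^-1
  ((fun y => x + r *: y)%R @` A); rewrite invr_gt0 => /(_ r0).
rewrite image_comp (_ : _ \o _ = id) ?image_id//; last first.
  by apply/funext => y /=; rewrite scalerDr scalerA mulVf ?gt_eqF// scale1r addKr.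
Qed.

Lemma lebesgue_Q k x r : (0 < r)%R ->
  lebesgue R n (Q k x r) = (r ^+ n)%:E * lebesgue R n (Q k 0%R 1%R).
Proof. by move=> r0; rewrite Q_scale//; exact: lebesgue_outer_scale. Qed.

Lemma maxr0_split (a b c : R) :
  (Num.max 0 (Num.min b c - a) + Num.max 0 (b - Num.max a c) = Num.max 0 (b - a))%R.
Proof.
rewrite {2}/Num.max {1}/Num.min; case: (ltP a c) => ?; case: (ltP b c) => ?;
  rewrite /Num.max; do ! (case: ltP => ?); lra.
Qed.

(** A hyperplane orthogonal to an axis cuts a box into two boxes whose volumes
    add up, so that it cuts every cover efficiently. *)
Lemma measurable_halfspace (i : 'I_n) (c : R) :
  measurable ([set x | (x ord0 i <= c)%R] : set (Rn R n)).
Proof.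
apply: le_caratheodory_measurable => X.
apply: le_ereal_inf_tmp => _ [F AF <-].
pose G k := if F k is Some (a, b) then
  Some (a, \row_j if j == i then Num.min (b ord0 i) c else b ord0 j)%R else None.
pose H k := if F k is Some (a, b) then
  Some (\row_j if j == i then Num.max (a ord0 i) c else a ord0 j, b)%R else None.
have -> : \sum_(k <oo) box_volume (F k) =
    \sum_(k <oo) box_volume (G k) + \sum_(k <oo) box_volume (H k).
  rewrite -nneseriesD; [|by move=> *; exact: box_volume_ge0..].
  apply: eq_eseriesr => k _; rewrite /G /H; case: (F k) => [[a b]|]/=;
    last by rewrite adde0.
  rewrite -EFinD; congr (_%:E); rewrite [LHS](bigD1 i)//=.
  rewrite [X in _ = (X + _)%R](bigD1 i)//= [X in _ = (_ + X)%R](bigD1 i)//=.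
  rewrite !mxE eqxx -(maxr0_split _ _ c) mulrDl.
  by congr (_ * _ + _ * _)%R; apply: eq_bigr => j /negPf ji; rewrite !mxE ji.
apply: leeD; apply: ereal_inf_lbound; [exists G|exists H] => //= y [Xy /= yc].
- have [k _ Fk] := AF y Xy; exists k => //; move: Fk; rewrite /box /G.
  case: (F k) => [[a b]|]//= h j; rewrite !mxE; have /andP[h1 h2] := h j.
  by case: eqP => [->|_]; rewrite ?h1//= le_min; have /andP[-> ->] := h i.
- have [k _ Fk] := AF y Xy; exists k => //; move: Fk; rewrite /box /H.
  case: (F k) => [[a b]|]//= h j; rewrite !mxE; have /andP[h1 h2] := h j.
  case: eqP => [->|_]; rewrite ?h1//= gt_max; have /andP[-> ->] := h i.
  by rewrite ltNge; move/negP: yc => ->.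
Qed.

Lemma measurable_halfspace_lt (i : 'I_n) (c : R) :
  measurable ([set x | (x ord0 i < c)%R] : set (Rn R n)).
Proof.
set S := (X in measurable X).
have -> : S = \bigcup_m [set x : Rn R n | (x ord0 i <= c - m.+1%:R^-1)%R]; last first.
  by apply: bigcup_measurable => m _; exact: measurable_halfspace.
apply/seteqP; split => [x xc|x [m _ /=] /le_lt_trans]; last first.
  by apply; rewrite ltrBlDr ltrDl invr_gt0.
have {}xc : (x ord0 i < c)%R by [].
by have [m hm] := ltr_add_invr xc; exists m => //=; rewrite lerBrDr ltW.
Qed.

Lemma measurable_cube y r : measurable (Q Cube y r : set (Rn R n)).
Proof.
have [r0|r0] := ltP 0%R r; last first.
  rewrite (_ : Q _ _ _ = set0)// -subset0 => x; rewrite /Q/= => /lt_le_trans /(_ r0).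
  by rewrite normr_lt0.
rewrite (_ : Q _ _ _ = \bigcap_(i in [set: 'I_n])
    ([set x : Rn R n | (x ord0 i < y ord0 i + r)%R] `\`
     [set x : Rn R n | (x ord0 i <= y ord0 i - r)%R])).
  apply: fin_bigcap_measurable; first exact: finite_finset.
  move=> i _; apply: measurableD;
    [exact: measurable_halfspace_lt|exact: measurable_halfspace].
apply/seteqP; split => [x /(sub_cubeP _ _ r0) h i _ /=|x h].
  by have /andP[h1 h2] := h i; split => //; apply/negP; rewrite -ltNge.
apply/(sub_cubeP _ _ r0) => i; have [/= -> /negP] := h i I.
by rewrite -ltNge => ->.
Qed.

End lebesgue_geometry.

Section rational_cubes.
Local Open Scope classical_set_scope.
Local Open Scope ring_scope.
Context {R : realType} {n : nat}.
Implicit Types (x y : 'rV[R]_n) (r s : R).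

Lemma cube_sub_cube x y r s : `|x - y| + r <= s -> Q Cube x r `<=` Q Cube y s.
Proof.
move=> h z; rewrite /Q/= => zx; rewrite -(subrKA x).
by apply: le_lt_trans (ler_normD _ _) _; lra.
Qed.

Definition rat_row (a : 'rV[rat]_n) : 'rV[R]_n := map_mx ratr a.

(** A cube can be squeezed between two concentric ones by a cube with rational
    data, so that countably many cubes can stand for all of them. *)
Lemma rational_cube y r s : 0 <= r -> r < s -> exists (a : 'rV[rat]_n) (b : rat),
  `|y - rat_row a| + r < ratr b /\ `|y - rat_row a| + ratr b < s.
Proof.
move=> r0 rs; pose d := (s - r) / 3; have d0 : 0 < d by rewrite /d; lra.
have /choice[a Ha] : forall i, exists q : rat,
    y ord0 i - d < ratr q < y ord0 i + d.
  move=> i; have /rat_in_itvoo[q] : y ord0 i - d < y ord0 i + d by lra.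
  by rewrite in_itv/=; exists q.
have /rat_in_itvoo[b] : r + d < r + 2 * d by lra.
rewrite in_itv/= => /andP[b1 b2].
have ya : `|y - rat_row (\row_i a i)| < d.
  by apply/(mx_norm_ltP _ d0) => i; rewrite !mxE distrC ltr_distl Ha.
by exists (\row_i a i), b; split; rewrite /d in ya b1 b2 *; lra.
Qed.

End rational_cubes.

Section lebesgue_positive.
Local Open Scope classical_set_scope.
Local Open Scope ring_scope.
Local Open Scope ereal_scope.
Context {R : realType}.

Lemma nneseries_ge_term (f : nat -> \bar R) k : (forall i, 0 <= f i) ->
  f k <= \sum_(i <oo) f i.
Proof.
move=> f0; rewrite (@nneseriesD1 _ f k xpredT)//.
by rewrite leeDl//; apply: nneseries_ge0 => *; exact: f0.
Qed.

(** The volume of a cover of the unit cube is at least one.  The coordinates are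
    integrated out one at a time, from the last: integrating the hypothesis over
    [0 < x_m <= 1] multiplies the weight [c k] by the length of the side [m] of
    the box [k].  The weights are there to make this induction possible. *)
Lemma unit_cube_cover_volume m (c : nat -> R) (a b : nat -> nat -> R) :
  (forall k, 0 <= c k)%R ->
  (forall x : nat -> R, (forall i, 0 < x i <= 1)%R ->
     1 <= \sum_(k <oo) (c k * \prod_(i < m) (a k i < x i <= b k i)%R%:R)%:E) ->
  1 <= \sum_(k <oo) (c k * \prod_(i < m) Num.max 0 (b k i - a k i))%:E.
Proof.
elim: m c => [|m IH] c c0 H.
  have := H (fun=> 1%R); rewrite ltr01 lexx => /(_ (fun=> isT)).
  by under eq_eseriesr do rewrite big_ord0;
    under [in X in _ -> X]eq_eseriesr do rewrite big_ord0.
under eq_eseriesr do rewrite big_ord_recr/= mulrCA mulrC.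
apply: IH => [k|x x01]; first by rewrite mulr_ge0// le_max lexx.
pose d k : R := (c k * \prod_(i < m) (a k i < x i <= b k i)%R%:R)%R.
have d0 k : (0 <= d k)%R by rewrite mulr_ge0// prodr_ge0.
pose D := `]0%R, 1%R]%classic : set (measurableTypeR R).
have mD : measurable D by exact: measurable_itv.
pose g k (t : measurableTypeR R) := (d k * \1_(`]a k m, b k m]%classic) t)%:E.
have mg k : measurable_fun D (g k).
  exact/measurable_EFinP/measurable_funM.
have g0 k t : 0 <= g k t by rewrite lee_fin mulr_ge0.
have int1 : \int[lebesgue_measure]_(t in D) (cst 1 t) = 1 :> \bar R.
  rewrite integral_cst/=; last exact: measurable_itv.
  by rewrite lebesgue_measure_itv/= lte_fin ltr01 oppr0 adde0 mule1.
have : \int[lebesgue_measure]_(t in D) (cst 1 t) <=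
  \int[lebesgue_measure]_(t in D) (\sum_(k <oo) g k t) :> \bar R.
  apply: ge0_le_integral => //.
  - exact: ge0_emeasurable_sum.
  move=> t; rewrite /D/= in_itv/= => t01.
  have := H (fun i => if i == m then t else x i).
  have Ht : forall i, (0 < (if i == m then t else x i) <= 1)%R.
    by move=> i; case: ifP.
  move=> /(_ Ht); congr (_ <= _); apply: eq_eseriesr => k _.
  rewrite big_ord_recr/= eqxx /g indicE mem_setE in_itv/= mulrA.
  congr ((_ * _ * _)%:E)%R.
  by apply: eq_bigr => i _; rewrite ltn_eqF.
rewrite int1 => /le_trans; apply.
rewrite integral_nneseries//.
apply: lee_nneseries => [k _ _|k _].
  by apply: integral_ge0 => t _; exact: g0.
under eq_integral do rewrite /g EFinM.
rewrite ge0_integralZl//; last 2 first.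
- exact/measurable_EFinP/measurable_indic.
- by rewrite lee_fin d0.
rewrite integral_indic//=.
rewrite [leRHS](_ : _ = (d k)%:E * (Num.max 0 (b k m - a k m))%:E); last first.
  by rewrite -EFinM /d mulrAC.
rewrite lee_wpmul2l ?lee_fin//.
apply: (@le_trans _ _ (lebesgue_measure (`]a k m, b k m]%classic :
  set (measurableTypeR R)))).
  by apply: le_measure; rewrite ?inE//; apply: measurableI => //; exact: measurable_itv.
rewrite lebesgue_measure_itv/= lte_fin; case: ltP => ab;
  rewrite -?EFinB lee_fin le_max ?lexx// orbT//.
Qed.

(** Empty boxes get the weight 0 and all the others the weight 1. *)
Lemma lebesgue_unit_cube_ge1 n :
  1 <= lebesgue_outer [set x : 'rV[R]_n | forall i, (0 < x ord0 i <= 1)%R].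
Proof.
apply: le_ereal_inf_tmp => _ [F AF <-].
pose z (y : 'rV[R]_n) i := oapp (y ord0) 0%R (insub i).
pose c k : R := if F k is Some _ then 1%R else 0%R.
pose a k : nat -> R := if F k is Some (a, _) then z a else fun=> 0%R.
pose b k : nat -> R := if F k is Some (_, b) then z b else fun=> 0%R.
have c0 k : (0 <= c k)%R by rewrite /c; case: (F k).
have zE y (i : 'I_n) : z y i = y ord0 i by rewrite /z valK.
have := @unit_cube_cover_volume n c a b c0; set S := (X in _ -> 1 <= X).
have -> : S = \sum_(k <oo) box_volume (F k).
  apply: eq_eseriesr => k _; rewrite /c /a /b; case: (F k) => [[u v]|]/=;
    last by rewrite mul0r.
  by rewrite mul1r; congr (_%:E); apply: eq_bigr => i _; rewrite !zE.
apply => x x01.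
have [|k _ Fk] := AF (\row_i x i); first by move=> i; rewrite mxE.
apply: le_trans (nneseries_ge_term k _); last by move=> i;
  rewrite lee_fin mulr_ge0// prodr_ge0.
rewrite lee_fin /c /a /b; move: Fk; rewrite /box/=; case: (F k) => [[u v]|]//= h.
rewrite mul1r big1// => i _; have := h i; rewrite !zE mxE => -> //.
Qed.

Context {n : nat}.
Hypothesis n0 : (0 < n)%N.

Lemma lebesgue_Q_fin_gt0 k : exists2 v : R, (0 < v)%R &
  forall (x : 'rV[R]_n) r, (0 < r)%R -> lebesgue R n (Q k x r) = (v * r ^+ n)%:E.
Proof.
pose m := lebesgue R n (Q k 0%R 1%R).
have mlt : m < +oo.
  pose a := const_mx (-1)%R : 'rV[R]_n; pose b := const_mx 1%R : 'rV[R]_n.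
  apply: (@le_lt_trans _ _ (box_volume (Some (a, b)))); last by rewrite ltry.
  apply: ereal_inf_lbound; exists (fun j => if j == 0%N then Some (a, b) else None).
    move=> x /Q_sub_cube /(sub_cubeP _ _ ltr01) h; exists 0%N => //= i.
    by have := h i; rewrite !mxE sub0r add0r => /andP[-> /ltW].
  rewrite (@nneseriesD1 _ _ 0 xpredT)//; last by move=> *; exact: box_volume_ge0.
  by rewrite eseries0 ?adde0// => i _ /= /negPf ->.
have mgt : 0 < m.
  have n0R : (0 < n%:R :> R)%R by rewrite ltr0n.
  have : 0 < lebesgue R n (Q k 0%R (n%:R * 2)%R).
    apply: (@lt_le_trans _ _ 1) => //; apply: le_trans (lebesgue_unit_cube_ge1 n) _.
    apply: le_lebesgue_outer => x x01; apply: cube_sub_Q => //.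
    apply/sub_cubeP => // i; have /andP[h1 h2] := x01 i; rewrite !mxE; lra.
  rewrite lebesgue_Q ?mulr_gt0//.
  by apply: contraTT; rewrite -!leNgt => m0; rewrite mule_ge0_le0.
have mfin : m \is a fin_num by rewrite ge0_fin_numE// ltW.
exists (fine m); first by rewrite fine_gt0// mgt.
by move=> x r r0; rewrite lebesgue_Q// -/m mulrC EFinM fineK.
Qed.

Lemma open_lebesgue_measurable (U : set 'rV[R]_n) : open U ->
  measurable (U : set (Rn R n)).
Proof.
move=> oU.
pose c (i : 'rV[rat]_n * rat) : set (Rn R n) := Q Cube (rat_row i.1) (ratr i.2).
pose F i := [set x | c i x /\ c i `<=` U].
have -> : U = \bigcup_i F i; last first.
  apply: (@countable_bigcupT_measurable _ (Rn R n) _ F).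
    exact: (@countableP ('rV[rat]_n * rat)%type).
  move=> i; have [ciU|nciU] := pselect (c i `<=` U).
    rewrite (_ : F i = c i); first exact: measurable_cube.
    by apply/seteqP; split => [x []|x].
  by rewrite (_ : F i = set0)// -subset0 => x [].
apply/seteqP; split => [x Ux|x [i _ [cix]]]; last exact.
have : nbhs x U by exact: open_nbhs_nbhs.
move=> /nbhs_ballP[e /= e0 eU].
have [a [b [h1 h2]]] := rational_cube x (lexx 0%R) e0.
exists (a, b) => //; split; first by rewrite addr0 in h1.
move=> y yab; apply: eU; rewrite -ball_normE/ball_/= distrC.
by apply: (cube_sub_cube _ yab); rewrite distrC ltW.
Qed.

Lemma measurable_Q k x r : measurable (Q k x r : set (Rn R n)).
Proof. exact/open_lebesgue_measurable/open_Q. Qed.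

End lebesgue_positive.

(** * The Hardy-Littlewood maximal function *)

Section maximal.
Local Open Scope classical_set_scope.
Local Open Scope ring_scope.
Local Open Scope ereal_scope.
Context {R : realType} {n : nat}.
Implicit Types (g : Rn R n -> \bar R) (c : 'rV[R]_n * R).

Notation mu := (lebesgue R n).
Let C c : set (Rn R n) := Q Cube c.1 c.2.
Let Us (s : seq ('rV[R]_n * R)) : set (Rn R n) := [set y | exists2 c, c \in s & C c y].

Let mC c : measurable (C c). Proof. exact: measurable_cube. Qed.

Let mUs s : measurable (Us s).
Proof.
elim: s => [|c s IH].
  by rewrite (_ : Us _ = set0)// -subset0 => y [].
rewrite (_ : Us _ = C c `|` Us s); first exact: measurableU.
apply/seteqP; split => [y [d]|y [cy|[d ds dy]]].
- by rewrite inE => /predU1P[->|ds dy]; [left|right; exists d].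
- by exists c; rewrite ?mem_head.
- by exists d; rewrite // inE ds orbT.
Qed.

Lemma largest_radius (s : seq ('rV[R]_n * R)) : s != [::] ->
  exists2 c, c \in s & forall d, d \in s -> (d.2 <= c.2)%R.
Proof.
elim: s => // c [|d s] IH _.
  by exists c => [|d]; rewrite !inE => // /eqP ->.
have [e es he] := IH isT.
have [ce|ec] := leP c.2 e.2.
  by exists e => [|f]; rewrite inE ?es ?orbT// => /predU1P[->|/he].
exists c => [|f]; first by rewrite mem_head.
rewrite inE => /predU1P[->//|/he fe]; exact: le_trans fe (ltW ec).
Qed.

(** The covering argument of Vitali, run on the measure rather than on the sets:
    take a cube [c] of largest radius and set aside the cubes that meet it, all of
    which lie in the cube of triple radius; the others are disjoint from [c], so
    that their union contributes a disjoint part of the integral. *)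
Lemma vitali_finite_bound g (z : R) s : (forall y, 0 <= g y) ->
  measurable_fun setT g -> (0 <= z)%R ->
  (forall c, c \in s -> (0 < c.2)%R /\ z%:E * mu (C c) <= \int[mu]_(y in C c) g y) ->
  z%:E * mu (Us s) <= (3 ^+ n)%:E * \int[mu]_(y in Us s) g y.
Proof.
move=> g0 mg z0; have [m] := ubnP (size s); elim: m s => // m IH s sm hs.
have [->|sN] := eqVneq s [::].
  by rewrite (_ : Us _ = set0) ?measure0 ?mule0 ?integral_set0 ?mule0// -subset0 => y [].
have [c cs cmax] := largest_radius sN.
have [c0 hc] := hs c cs.
pose s' := [seq d <- s | `[< C d `&` C c = set0 >]].
have ss' : {subset s' <= s} by move=> d; rewrite mem_filter => /andP[].
have s'm : (size s' < m)%N.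
  apply: leq_trans (_ : (size s <= m)%N); last by [].
  rewrite size_filter -(count_predC (fun d => `[< C d `&` C c = set0 >]) s).
  rewrite -[ltnLHS]addn0 ltn_add2l -has_count; apply/hasP; exists c => //=.
  apply/asboolPn; rewrite setIid => /seteqP[+ _] => /(_ c.1); apply.
  exact: Q_center.
have := IH s' s'm (fun d ds' => hs d (ss' _ ds')) => {}IH.
pose c3 : set (Rn R n) := Q Cube c.1 (3 * c.2)%R.
have sub : Us s `<=` c3 `|` Us s'.
  move=> y [d ds dy]; have [dc|] := pselect (C d `&` C c = set0).
    by right; exists d => //; rewrite mem_filter ds andbT; apply/asboolP.
  move=> /eqP/set0P[w [dw cw]]; left.
  have := cmax d ds; move: dy dw cw; rewrite /c3 /C /Q/= => dy dw cw dc.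
  have -> : (y - c.1 = (y - d.1) - (w - d.1) + (w - c.1))%R
    by rewrite opprB !addrA !subrK.
  apply: le_lt_trans (ler_normD _ _) _.
  apply: (@le_lt_trans _ _ (`|y - d.1| + `|w - d.1| + `|w - c.1|)%R).
    by rewrite lerD2r; exact: ler_normB.
  by lra.
have disj : [disjoint C c & Us s'].
  apply/disj_setPLR => y cy [d]; rewrite mem_filter => /andP[/asboolP dc _] dy.
  by have : (C d `&` C c) y by []; rewrite dc.
apply: (@le_trans _ _ (z%:E * mu c3 + z%:E * mu (Us s'))).
  rewrite -ge0_muleDr ?measure_ge0// lee_wpmul2l ?lee_fin//.
  apply: le_trans (measureU2 _ _ _) => //; last exact: measurable_cube.
  by apply: le_measure; rewrite ?inE//; apply: measurableU => //; exact: measurable_cube.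
apply: (@le_trans _ _ ((3 ^+ n)%:E * \int[mu]_(y in C c `|` Us s') g y)); last first.
  rewrite lee_wpmul2l ?lee_fin ?exprn_ge0//.
  apply: ge0_subset_integral => //; [exact: measurableU|exact: measurable_funTS|].
  by move=> y [cy|[d /ss' ds dy]]; [exists c|exists d].
rewrite ge0_integral_setU//; last exact: measurable_funTS.
rewrite ge0_muleDr ?integral_ge0//; apply: leeD => //.
rewrite /c3 lebesgue_Q ?mulr_gt0// exprMn EFinM -muleA -(lebesgue_Q Cube c.1)//.
by rewrite muleCA lee_wpmul2l// lee_fin exprn_ge0.
Qed.

(** The superlevel set at height [z] of the uncentred Hardy-Littlewood maximal
    function of [g], given as a union of open cubes. *)
Definition maximal_above g (z : R) : set (Rn R n) := [set y |
  exists y0 r, [/\ (0 < r)%R, Q Cube y0 r y &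
    z%:E * mu (Q Cube y0 r) < \int[mu]_(v in Q Cube y0 r) g v]].

Lemma measurable_maximal_above g z : measurable (maximal_above g z).
Proof.
apply: open_lebesgue_measurable.
rewrite (_ : maximal_above g z = \bigcup_(c in [set c | (0 < c.2)%R /\
   z%:E * mu (C c) < \int[mu]_(v in C c) g v]) (C c : set 'rV[R]_n)).
  by apply: bigcup_open => c _; exact: open_Q.
apply/seteqP; split => [y [y0 [r [r0 yr h]]]|y [[y0 r] [/= r0 h] yr]].
  by exists (y0, r).
by exists y0, r.
Qed.

Hypothesis n0 : (0 < n)%N.

(** By strict inequality, a cube witnessing membership can be enlarged slightly to
    one with rational data, so that countably many cubes suffice; the finite bound
    then passes to the limit by continuity from below. *)
Lemma weak_type11 g (z : R) : (forall y, 0 <= g y) ->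
  measurable_fun setT g -> (0 <= z)%R ->
  z%:E * mu (maximal_above g z) <= (3 ^+ n)%:E * \int[mu]_y g y.
Proof.
move=> g0 mg z0.
pose good c := (0 < c.2)%R /\ z%:E * mu (C c) < \int[mu]_(v in C c) g v.
pose ratc (i : 'rV[rat]_n * rat) : 'rV[R]_n * R := (rat_row i.1, ratr i.2).
pose s m := [seq c <- pmap (fun j => omap ratc (unpickle j)) (iota 0 m) | `[< good c >]].
have sU : maximal_above g z `<=` \bigcup_m Us (s m).
  move=> y [y0 [r [r0 yr h]]].
  have [v v0 vE] := lebesgue_Q_fin_gt0 (R := R) n0 Cube.
  have [t [rt ht]] : exists t, (r < t)%R /\ (z * (v * t ^+ n))%:E < \int[mu]_(v in Q
    Cube y0 r) g v.
    move: h; rewrite vE//; case: (\int[mu]_(v in Q Cube y0 r) g v) => [I||]//; last first.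
      by move=> _; exists (r + 1)%R; rewrite ltry ltrDl.
    rewrite -EFinM lte_fin => hI.
    have : (fun t => z * (v * t ^+ n))%R t @[t --> r^'+] --> (z * (v * r ^+ n))%R.
      apply: cvg_at_right_filter; apply: cvgM; first exact: cvg_cst.
      by apply: cvgM; [exact: cvg_cst|exact: exprn_continuous].
    move=> /cvgr_lt /(_ _ hI) H.
    have [t [Ht rt]] := filter_ex (filterI H (nbhs_right_gt r)).
    by exists t; rewrite lte_fin.
  have [a [b [h1 h2]]] := rational_cube y0 (ltW r0) rt.
  have sub : Q Cube y0 r `<=` C (ratc (a, b)) by apply: cube_sub_cube; exact: ltW.
  have b0 : (0 < ratr b :> R)%R by apply: le_lt_trans h1; rewrite addr_ge0// ltW.
  have gd : good (ratc (a, b)).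
    split => //; apply: (@lt_le_trans _ _ (\int[mu]_(v in Q Cube y0 r) g v)); last first.
      apply: ge0_subset_integral => //; [exact: measurable_cube|exact: measurable_funTS].
    apply: le_lt_trans ht;
      rewrite /C vE// -EFinM lee_fin ler_wpM2l// ler_wpM2l// ?(ltW v0)//.
    rewrite lerXn2r ?nnegrE ?(ltW b0)//=; first by rewrite (le_trans (ltW r0))// ltW.
    by apply: ltW; apply: le_lt_trans h2; rewrite lerDr.
  exists (pickle (a, b)).+1 => //; exists (ratc (a, b)); last exact: sub.
  rewrite mem_filter; apply/andP; split; first exact/asboolP.
  rewrite mem_pmap; apply/mapP; exists (pickle (a, b)); last by rewrite pickleK.
  by rewrite mem_iota add0n ltnSn.
have nd : nondecreasing_seq (fun m => Us (s m)).
  move=> m1 m2 m12; apply/subsetPset => y [c]; rewrite mem_filter => /andP[gc cm] cy.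
  exists c => //; rewrite mem_filter gc/=; move: cm; rewrite !mem_pmap => /mapP[j jm ->].
  apply/mapP; exists j => //; move: jm; rewrite !mem_iota !add0n /=;
    by move=> /leq_trans; apply.
have bound m : z%:E * mu (Us (s m)) <= (3 ^+ n)%:E * \int[mu]_y g y.
  apply: (@le_trans _ _ ((3 ^+ n)%:E * \int[mu]_(y in Us (s m)) g y)).
    apply: vitali_finite_bound => // c;
      rewrite mem_filter => /andP[/asboolP [c0 /ltW hc] _].
    by split.
  rewrite lee_wpmul2l ?lee_fin ?exprn_ge0//.
  by apply: ge0_subset_integral.
have cv : (mu \o (fun m => Us (s m))) @ \oo --> mu (\bigcup_m Us (s m)).
  by apply: nondecreasing_cvg_mu => //; exact: bigcup_measurable.
apply: (@le_trans _ _ (z%:E * mu (\bigcup_m Us (s m)))).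
  rewrite lee_wpmul2l ?lee_fin//; apply: le_measure; rewrite ?inE//.
    exact: measurable_maximal_above.
  exact: bigcup_measurable.
have cvz := cvgeZl (isT : z%:E \is a fin_num) cv.
rewrite -(cvg_lim _ cvz)//; apply: lime_le; first by apply/cvg_ex; eexists; exact: cvz.
by near=> m; exact: bound.
Unshelve. all: by end_near. Qed.

End maximal.

Section strong.
Local Open Scope classical_set_scope.
Local Open Scope ring_scope.
Local Open Scope ereal_scope.
Context {R : realType}.

Lemma nneseries_le_bound (f : nat -> \bar R) M : (forall k, 0 <= f k) ->
  (forall m, \sum_(0 <= k < m) f k <= M) -> \sum_(k <oo) f k <= M.
Proof.
move=> f0 fM; apply: lime_le; first by apply: is_cvg_nneseries => k *; exact: f0.
by near=> m; exact: fM.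
Unshelve. all: by end_near. Qed.

Lemma powR2_gt1 (a : R) : (0 < a)%R -> (1 < 2 `^ a)%R.
Proof.
by move=> a0; have := @gt0_ltr_powR R a a0 1%R 2%R; rewrite powR1 !nnegrE ltr1n; apply.
Qed.

(** The sum is dominated by its last nonzero term, for which [2 ^+ k < x]. *)
Lemma truncated_geometric_sum (a x : R) m : (0 < a)%R -> (0 <= x)%R ->
  (\sum_(0 <= k < m) (2 `^ a) ^+ k * (2 ^+ k < x)%R%:R <=
    2 `^ a / (2 `^ a - 1) * x `^ a)%R.
Proof.
move=> a0 x0; set b := (2 `^ a)%R.
have b1 : (1 < b)%R by exact: powR2_gt1.
have b10 : (0 < b - 1)%R by rewrite subr_gt0.
have b0 : (0 < b)%R by apply: lt_trans b1.
suff : (\sum_(0 <= k < m) b ^+ k * (2 ^+ k < x)%R%:R <= b / (b - 1) * x `^ a)%R /\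
       (\sum_(0 <= k < m) b ^+ k * (2 ^+ k < x)%R%:R <= b ^+ m / (b - 1))%R by case.
elim: m => [|m [IH1 IH2]].
  by rewrite big_geq// expr0; split;
    rewrite ?mulr_ge0 ?powR_ge0 ?invr_ge0 ?(ltW b0) ?(ltW b10).
have key : (b ^+ m / (b - 1) + b ^+ m = b ^+ m.+1 / (b - 1))%R.
  by rewrite exprS; field; rewrite gt_eqF.
rewrite big_nat_recr//=; split.
  case: ltP => [mx|_]; last by rewrite mulr0 addr0.
  rewrite mulr1; apply: (@le_trans _ _ (b ^+ m.+1 / (b - 1))%R).
    by rewrite -key lerD2r.
  rewrite exprS -mulrA (mulrC (b ^+ m)%R) mulrA ler_wpM2l ?divr_ge0 ?ltW//.
  rewrite /b -powR_mulrn ?powR_ge0// -powRrM mulrC powRrM powR_mulrn//.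
  by apply: gt0_ltr_powR; rewrite ?nnegrE ?exprn_ge0.

rewrite -key lerD// -[leRHS]mulr1 ler_wpM2l ?exprn_ge0 ?(ltW b0)//.
by case: (_ < _)%R.
Qed.

Context {n : nat}.
Notation mu := (lebesgue R n).
Implicit Types (g : Rn R n -> \bar R).

Hypothesis n0 : (0 < n)%N.

Let mA g (z : R) : measurable_fun setT g -> measurable [set y | z%:E < g y].
Proof.
move=> mg; rewrite -[X in measurable X]setTI.
exact: emeasurable_fun_o_infty.
Qed.

(** The part of [g] below [z] contributes at most [z] to any mean. *)
Lemma weak_type11_truncated g (z : R) : (forall y, 0 <= g y) ->
  measurable_fun setT g -> (0 <= z)%R ->
  z%:E * mu (maximal_above g (2 * z)) <=
  (3 ^+ n)%:E * \int[mu]_(y in [set y | z%:E < g y]) g y.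
Proof.
move=> g0 mg z0; set A := [set y | z%:E < g y].
have mAz : measurable A by exact: mA.
have mgA : measurable_fun setT (g \_ A).
  by apply/(measurable_restrictT _ _).1 => //; exact: measurable_funTS.
have gA0 y : 0 <= (g \_ A) y by rewrite patchE; case: ifP.
rewrite (integral_mkcond A).
apply: le_trans (weak_type11 n0 gA0 mgA z0).
rewrite lee_wpmul2l ?lee_fin//; apply: le_measure; rewrite ?inE//;
  [exact: measurable_maximal_above..|].
move=> y [y0 [r [r0 yr h]]]; exists y0, r; split => //.
have mQ : measurable (Q Cube y0 r : set (Rn R n)) by exact: measurable_cube.
have muQ : mu (Q Cube y0 r) \is a fin_num.
  by have [v v0 ->] := lebesgue_Q_fin_gt0 (R := R) n0 Cube.
have : \int[mu]_(v in Q Cube y0 r) g v <=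
  \int[mu]_(v in Q Cube y0 r) (g \_ A) v + z%:E * mu (Q Cube y0 r).
  rewrite -(integral_cst mu mQ) -ge0_integralD//; last exact: measurable_funTS.
  apply: ge0_le_integral.
  - exact: mQ.
  - by move=> x _; exact: g0.
  - exact: measurable_funTS.
  - apply: emeasurable_funD; first exact: measurable_funTS.
    exact: measurable_cst.
  move=> x _; rewrite patchE; case: ifPn => [_|]; first by rewrite leeDl.
  by rewrite notin_setE /A/= => /negP; rewrite -leNgt add0e.
move=> /(lt_le_trans h); rewrite EFinM -muleA mule_natl.
by rewrite [X in X < _]mule2n lteD2rE// fin_numM.
Qed.

(** The left-hand side is a discrete form of the integral of the [p]-th power of
    the maximal function over the set where it exceeds [B].  The truncated weak
    type inequality bounds each term by an integral over a superlevel set of [g];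
    exchanging sum and integral, a point where [g] equals [t] is counted for the
    levels [2 ^+ k < 2 * t / B] only, and these form a geometric sum. *)
Lemma strong_type (p : R) : (1 < p)%R -> exists2 C : R, (0 < C)%R &
  forall g (B : R), (forall y, 0 <= g y) -> measurable_fun setT g -> (0 < B)%R ->
  \sum_(k <oo) ((2 `^ p) ^+ k)%:E * mu (maximal_above g (2 ^+ k * B)) <=
  (C / B `^ p)%:E * \int[mu]_y (g y `^ p).
Proof.
move=> p1; have a0 : (0 < p - 1)%R by rewrite subr_gt0.
pose b : R := (2 `^ (p - 1))%R.
have b1 : (1 < b)%R by exact: powR2_gt1.
have b0 : (0 < b)%R by apply: lt_trans b1.
have bE : (2 `^ p = 2 * b)%R by rewrite mulr_powRB1// (lt_trans _ p1).
pose K : R := (b / (b - 1))%R.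
have K0 : (0 < K)%R by rewrite divr_gt0// subr_gt0.
exists (2 * 3 ^+ n * K * b)%R.
  by do 3 (apply: mulr_gt0 => //); rewrite exprn_gt0.
move=> g B g0 mg B0.
have Cp : (0 < 2 * 3 ^+ n * K * b / B `^ p)%R.
  apply: divr_gt0; last exact: powR_gt0.
  by do 3 (apply: mulr_gt0 => //); rewrite exprn_gt0.
pose A k := [set y | (2 ^+ k * B / 2)%:E < g y].
pose h k y := (2 * 3 ^+ n / B * b ^+ k)%:E * (g \_ (A k)) y.
have mAk k : measurable (A k) by exact: mA.
have c0 k : (0 <= 2 * 3 ^+ n / B * b ^+ k)%R.
  by rewrite !mulr_ge0 ?invr_ge0 ?exprn_ge0 ?ltW.
have h0 k y : 0 <= h k y.
  by apply: mule_ge0; rewrite ?lee_fin// patchE; case: ifP.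
have mgA k : measurable_fun setT (g \_ (A k)).
  by apply/(measurable_restrictT _ _).1 => //; exact: measurable_funTS.
have mh k : measurable_fun setT (h k) by exact: measurable_funeM.
apply: (@le_trans _ _ (\sum_(k <oo) \int[mu]_y h k y)).
  apply: lee_nneseries => [k _ _|k _]; first by apply: mule_ge0;
    rewrite ?lee_fin ?exprn_ge0 ?powR_ge0.
  rewrite ge0_integralZl//; last 2 first.
    by move=> y _; rewrite patchE; case: ifP.
    by rewrite lee_fin.
  rewrite -(integral_mkcond (A k)).
  have z0 : (0 < 2 ^+ k * B / 2)%R by rewrite !mulr_gt0 ?exprn_gt0//.
  have := weak_type11_truncated g0 mg (ltW z0).
  have -> : (2 * (2 ^+ k * B / 2) = 2 ^+ k * B)%R by field.
  rewrite -lee_pdivlMl// => /(lee_wpmul2l (x := ((2 `^ p) ^+ k)%:E)).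
  rewrite lee_fin exprn_ge0 ?powR_ge0// => /(_ isT) /le_trans; apply.
  rewrite !muleA -!EFinM lee_wpmul2r ?integral_ge0//.
  rewrite lee_fin bE exprMn le_eqVlt; apply/orP; left; apply/eqP; field.
  by rewrite gt_eqF// expf_neq0.
rewrite -(integral_nneseries mu measurableT); last 2 first.
- exact: mh.
- by move=> k y _; exact: h0.
have mgp : measurable_fun setT (fun y => g y `^ p).
  exact: (measurableT_comp (measurable_poweR _)).
rewrite -(ge0_integralZl mu measurableT mgp); last 2 first.
- by move=> y _; exact: poweR_ge0.
- by rewrite lee_fin ltW.
apply: ge0_le_integral.
- exact: measurableT.
- by move=> y _; apply: nneseries_ge0 => k _ _; exact: h0.
- exact: ge0_emeasurable_sum.
- exact: measurable_funeM.
move=> y _; have := g0 y.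
case E : (g y) => [t||]//; last first.
  move=> _; rewrite poweRyr ?gt_eqF ?(lt_trans _ p1)// gt0_muley ?lte_fin//.
  by rewrite leey.
rewrite lee_fin => t0; rewrite poweR_EFin -EFinM.
apply: nneseries_le_bound => // m.
have hE k : h k y = (2 * 3 ^+ n / B * t * (b ^+ k * (2 ^+ k < 2 * t / B)%R%:R))%:E.
  rewrite /h patchE; have -> : (y \in A k) = ((2 ^+ k * B / 2)%:E < g y).
    by apply/idP/idP; rewrite inE.
  rewrite E lte_fin ltr_pdivlMr//.
  rewrite (_ : (_ < t)%R = (2 ^+ k * B < 2 * t)%R);
    last by rewrite ltr_pdivrMr// (mulrC t).
  case: ifP => _; last by rewrite mule0 !mulr0.
  by rewrite -EFinM mulr1; congr (_%:E); ring.
under eq_bigr do rewrite hE.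
rewrite sumEFin lee_fin -mulr_sumr.
have tB0 : (0 <= 2 * t / B)%R by rewrite divr_ge0 ?mulr_ge0 ?(ltW B0).
apply: le_trans (ler_wpM2l _ (truncated_geometric_sum m a0 tB0)) _.
  apply: mulr_ge0 => //; apply: divr_ge0; last exact: ltW.
  by rewrite mulr_ge0 ?exprn_ge0.
rewrite -/b -/K powRM ?mulr_ge0 ?invr_ge0 ?(ltW B0)// powRM// -/b.
have -> : (B^-1 `^ (p - 1) = (B `^ (p - 1))^-1)%R.
  by rewrite -powR_inv1 ?(ltW B0)// powRAC powR_inv1 ?powR_ge0.
have p0 : (0 < p)%R by apply: lt_trans p1.
rewrite -(mulr_powRB1 t0 p0) -(mulr_powRB1 (ltW B0) p0).
rewrite le_eqVlt; apply/orP; left; apply/eqP; field.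
by rewrite !gt_eqF// powR_gt0.
Qed.
End strong.

(** * The fractional maximal operator on a single cube *)

Section powers.
Local Open Scope ring_scope.
Context {R : realType}.

Lemma gt0_powRE (x y : R) : 0 < x -> x `^ y = expR (y * ln x).
Proof. by move=> x0; rewrite /powR gt_eqF. Qed.

Lemma le_powR_interpolation (a x y t : R) : 0 <= t <= 1 -> 0 <= a ->
  a <= x -> a <= y -> a <= x `^ t * y `^ (1 - t).
Proof.
move=> /andP[t0 t1]; rewrite le_eqVlt => /predU1P[<- _ _|a0 ax ay].
  by rewrite mulr_ge0 ?powR_ge0.
have -> : a = a `^ t * a `^ (1 - t).
  by rewrite -powRD ?(gt_eqF a0) ?implybT// addrCA subrr addr0 powRr1// ltW.
by apply: ler_pM; rewrite ?powR_ge0// ge0_ler_powR ?nnegrE ?subr_ge0//;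
  rewrite ?(ltW a0)// (le_trans (ltW a0)).
Qed.

Lemma le0_ger_powR (e x y : R) : e <= 0 -> 0 < x -> x <= y -> y `^ e <= x `^ e.
Proof.
move=> e0 x0 xy; have y0 : 0 < y by apply: lt_le_trans xy.
rewrite !gt0_powRE// ler_expR ler_wnM2l// ler_ln//.
Qed.

Lemma powR_exprn (a p : R) m : 0 <= a -> (a `^ p) ^+ m = (a ^+ m) `^ p.
Proof.
by move=> a0; rewrite -powR_mulrn ?powR_ge0// powRAC powR_mulrn.
Qed.

Local Open Scope ereal_scope.

(** Where [t] exceeds [B], it is at most [t ^ p / B ^ (p - 1)].  This replaces the
    inequality of Hoelder in comparing means of different orders. *)
Lemma le_add_powR (t : \bar R) (B p : R) : 0 <= t -> (0 < B)%R -> (1 <= p)%R ->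
  t <= B%:E + (B `^ (1 - p))%:E * t `^ p.
Proof.
have Bp : (0 < B)%R -> (0 < B `^ (1 - p))%R by exact: powR_gt0.
case: t => [t||]//; last first.
  move=> _ B0 p1; rewrite poweRyr ?gt_eqF ?(lt_le_trans _ p1)//.
  by rewrite gt0_muley ?lte_fin ?Bp// addey.
rewrite lee_fin => t0 B0 p1; rewrite poweR_EFin -EFinM -EFinD lee_fin.
have [tB|Bt] := leP t B; first by rewrite ler_wpDr// mulr_ge0 ?powR_ge0.
have t0' : (0 < t)%R by apply: lt_trans Bt.
rewrite ler_wpDl ?(ltW B0)//.
rewrite -[leLHS](powRr1 t0) !gt0_powRE// -expRD ler_expR.
have : (0 <= (p - 1) * (ln t - ln B))%R.
  by rewrite mulr_ge0 ?subr_ge0// ler_ln// ltW.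
by lra.
Qed.

(** The quantities whose suprema are the Morrey norms are compared with a constant
    by clearing the root and the denominators. *)
Lemma normalized_mean_leP (a V p K : R) (I : \bar R) :
  (0 < a)%R -> (0 < V)%R -> (0 < p)%R -> (0 <= K)%R -> 0 <= I ->
  ((a^-1)%R%:E * (I / V%:E) `^ p^-1 <= K%:E) = (I <= (V * (a * K) `^ p)%:E).
Proof.
move=> a0 V0 p0 K0 I0; rewrite lee_pdivrMl// -EFinM inver gt_eqF//.
have aK0 : (0 <= a * K)%R by rewrite mulr_ge0// ltW.
have pN0 : p != 0%R by rewrite gt_eqF.
have IV0 : 0 <= I * V^-1%:E by rewrite mule_ge0// lee_fin invr_ge0 ltW.
rewrite (mulrC V) (EFinM _ V) -(lee_pdivrMr _ _ V0).
apply/idP/idP => h.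
- have := @gt0_ler_poweR _ p (ltW p0) ((I * V^-1%:E) `^ p^-1) (a * K)%:E.
  rewrite !in_itv/= !leey !andbT poweR_ge0 lee_fin aK0 => /(_ isT isT h).
  by rewrite -poweRrM mulVf// poweRe1.
- have := @gt0_ler_poweR _ p^-1 _ (I * V^-1%:E) ((a * K) `^ p)%:E.
  rewrite invr_ge0 ltW// !in_itv/= !leey !andbT lee_fin IV0 powR_ge0.
  move=> /(_ isT isT isT h).
  by rewrite -powRrM divff// powRr1.
Qed.

Lemma powR_infty_bound (b x : R) : (0 < b)%R -> (0 < x)%R ->
  exists m : nat, (x <= (2 ^+ m) `^ b)%R.
Proof.
move=> b0 x0; have [m hm] : exists m : nat, (x `^ b^-1 <= 2 ^+ m)%R.
  have [m hm] : exists m : nat, (x `^ b^-1 < m%:R)%R.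
    by exists (Num.bound (x `^ b^-1)%R); rewrite archi_boundP// powR_ge0.
  exists m; rewrite (le_trans (ltW hm))// -natrX ler_nat ltnW// ltn_expl//.
exists m; have := @ge0_ler_powR R b (ltW b0) (x `^ b^-1)%R (2 ^+ m)%R.
by rewrite !nnegrE powR_ge0 exprn_ge0// => /(_ isT isT hm);
  rewrite -powRrM mulVf ?gt_eqF// powRr1// ltW.
Qed.

End powers.

Section local.
Local Open Scope classical_set_scope.
Local Open Scope ring_scope.
Local Open Scope ereal_scope.
Context {R : realType} {n : nat}.
Hypothesis n0 : (0 < n)%N.
Implicit Types (f g : Rn R n -> \bar R) (x : 'rV[R]_n).

Notation leb := (lebesgue R n).

Let n1 : (1 <= n%:R :> R)%R. Proof. by rewrite ler1n. Qed.

Lemma measurable_abse_poweR f (p : R) D : measurable_fun setT f ->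
  measurable_fun D (fun y => `|f y| `^ p).
Proof.
move=> mf; apply: (@measurable_funTS _ _ _ _ _ _).
apply: (measurableT_comp (measurable_poweR _)).
exact: measurableT_comp.
Qed.

(** The cube is inscribed in a set [Q k] of radius [n r], itself contained in the
    set [Q0 k rho]; each passage between cubes and balls costs a factor [n]. *)
Lemma integral_cube_le_morrey k (p lam : R) : (0 < p)%R ->
  exists2 C : R, (0 < C)%R & forall f (K r rho : R) (y : 'rV[R]_n),
    measurable_fun setT f -> (0 <= K)%R -> (0 < r)%R ->
    (n%:R * (n%:R * r + `|y|) <= rho)%R ->
    morrey_norm k p lam (Q0 k rho) f <= K%:E ->
    \int[leb]_(z in Q Cube y r) (`|f z| `^ p) <=
      (C * r ^+ n * (r `^ lam * K) `^ p)%:E.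
Proof.
move=> p0; have [v v0 vE] := lebesgue_Q_fin_gt0 (R := R) n0 k.
have n0R : (0 < n%:R :> R)%R by rewrite ltr0n.
exists (v * n%:R ^+ n * (n%:R `^ lam) `^ p)%R.
  by rewrite !mulr_gt0 ?powR_gt0 ?exprn_gt0.
move=> f K r rho y mf K0 r0 rrho fK.
have nr0 : (0 < n%:R * r)%R by rewrite mulr_gt0.
have Qsub : Q k y (n%:R * r) `<=` Q0 k rho.
  move=> z /Q_sub_cube zQ; apply: (Q0_mono rrho).
  rewrite Q0E; apply: cube_sub_Q => //; apply: (cube_sub_cube _ zQ).
  by rewrite subr0 addrC.
have nrl : (0 < (n%:R * r) `^ lam)%R by rewrite powR_gt0.
have V0 : (0 < v * (n%:R * r) ^+ n)%R by rewrite mulr_gt0 ?exprn_gt0.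
apply: (@le_trans _ _ (\int[leb]_(z in Q k y (n%:R * r)) (`|f z| `^ p))).
  apply: ge0_subset_integral.
  - exact: measurable_cube.
  - exact: measurable_Q.
  - exact: measurable_abse_poweR.
  - by move=> *; exact: poweR_ge0.
  - exact: cube_sub_Q.
have -> : (v * n%:R ^+ n * (n%:R `^ lam) `^ p * r ^+ n * (r `^ lam * K) `^ p =
   v * (n%:R * r) ^+ n * ((n%:R * r) `^ lam * K) `^ p)%R.
  rewrite exprMn (powRM _ (ltW n0R) (ltW r0)) -(mulrA (n%:R `^ lam)%R).
  rewrite (@powRM _ (n%:R `^ lam)%R) ?mulr_ge0 ?powR_ge0//.
  by rewrite -!mulrA; do 2 congr (_ * _)%R; rewrite mulrCA.
rewrite -normalized_mean_leP//; last first.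
  by apply: integral_ge0 => *; exact: poweR_ge0.
apply: le_trans fK; apply: ereal_sup_ubound.
by exists y, (n%:R * r)%R; split => //; rewrite vE.
Qed.

Lemma integral_cube_le_mean k (p lam : R) : (1 <= p)%R ->
  exists2 C : R, (0 < C)%R & forall f (K r rho : R) (y : 'rV[R]_n),
    measurable_fun setT f -> (0 < K)%R -> (0 < r)%R ->
    (n%:R * (n%:R * r + `|y|) <= rho)%R ->
    morrey_norm k p lam (Q0 k rho) f <= K%:E ->
    \int[leb]_(z in Q Cube y r) `|f z| <= (C * r ^+ n * (r `^ lam * K))%:E.
Proof.
move=> p1; have p0 : (0 < p)%R by apply: lt_le_trans p1.
have [v v0 vE] := lebesgue_Q_fin_gt0 (R := R) n0 Cube.
have [C C0 HC] := integral_cube_le_morrey k lam p0.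
exists (v + C)%R; first by rewrite addr_gt0.
move=> f K r rho y mf K0 r0 rrho fK.
have := HC f K r rho y mf (ltW K0) r0 rrho fK => {}HC.
pose B := (r `^ lam * K)%R; have B0 : (0 < B)%R by rewrite mulr_gt0 ?powR_gt0.
have mQ : measurable (Q Cube y r : set (Rn R n)) by exact: measurable_cube.
apply: (@le_trans _ _ (\int[leb]_(z in Q Cube y r)
    (B%:E + (B `^ (1 - p))%:E * (`|f z| `^ p)))).
  apply: ge0_le_integral.
  - exact: mQ.
  - by [].
  - by apply: measurable_funTS; exact: measurableT_comp.
  - apply: emeasurable_funD; first exact: measurable_cst.
    by apply: measurable_funeM; exact: measurable_abse_poweR.
  - by move=> z _; exact: le_add_powR.
have mfp : measurable_fun (Q Cube y r : set (Rn R n)) (fun z => `|f z| `^ p).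
  exact: measurable_abse_poweR.
rewrite ge0_integralD; last 5 first.
- exact: mQ.
- by move=> *; rewrite lee_fin ltW.
- exact: measurable_cst.
- by move=> *; rewrite mule_ge0 ?poweR_ge0// lee_fin powR_ge0.
- exact: measurable_funeM.
rewrite integral_cst// ge0_integralZl//; last 2 first.
- by move=> *; exact: poweR_ge0.
- by rewrite lee_fin powR_ge0.
rewrite [X in _ * X + _](_ : _ = (v * r ^+ n)%:E); last exact: vE.
apply: (@le_trans _ _ (B%:E * (v * r ^+ n)%:E + (B `^ (1 - p))%:E * (C * r ^+ n * B `^
  p)%:E)).
  by rewrite leeD2l// lee_wpmul2l// lee_fin powR_ge0.
rewrite -!EFinM -EFinD lee_fin -/B.
have BB : (B `^ (1 - p) * B `^ p = B)%R.
  by rewrite -powRD ?(gt_eqF B0) ?implybT// subrK powRr1// ltW.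
rewrite le_eqVlt; apply/orP; left; apply/eqP.
transitivity (B * v * r ^+ n + C * r ^+ n * (B `^ (1 - p) * B `^ p))%R; first by ring.
by rewrite BB; ring.
Qed.

(** The inequality of the radii is read off the measures. *)
Lemma sub_Q0_center k x (s r : R) : (0 < s)%R -> Q k x s `<=` Q0 k r ->
  (`|x| < r)%R /\ (s <= r)%R.
Proof.
move=> s0 sub; have xr := sub _ (Q_center k x s0).
have xr' : (`|x| < r)%R.
  by move: xr; rewrite Q0E => /Q_sub_cube; rewrite /Q/= subr0.
have r0 : (0 < r)%R by apply: le_lt_trans xr'.
split => //; have [v v0 vE] := lebesgue_Q_fin_gt0 (R := R) n0 k.
have := le_outer_measure (lebesgue_outer_measure R n) _ _ sub; rewrite Q0E.
rewrite [leLHS]vE// [leRHS]vE// lee_fin ler_pM2l//.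
by rewrite ler_pXn2r// nnegrE ltW.
Qed.

Lemma frac_maximal_ge0 k (alpha : R) f y : 0 <= frac_maximal k alpha f y.
Proof.
apply: (@le_trans _ _ (leb (Q k y 1) `^ (- 1 + alpha / n%:R)%R *
        \int[leb]_(v in Q k y 1) `|f v|)).
  by rewrite mule_ge0 ?poweR_ge0 ?integral_ge0.
apply: ereal_sup_ubound; exists y, 1%R; split => //.
exact: Q_center.
Qed.

(** A set that witnesses a large value at one point does so at all of its points,
    so the superlevel sets are open. *)
Lemma measurable_frac_maximal k (alpha : R) f :
  measurable_fun setT (frac_maximal k alpha f).
Proof.
move=> _; apply: (measurability _ (ErealGenOInfty.measurableE R)) => //.
move=> _ [_ [t ->] <-]; rewrite setTI.
apply: open_lebesgue_measurable.
rewrite openE => y /=; rewrite in_itv/= andbT => /ereal_sup_gt[_ [z [s [s0 zy ->]]] ht].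
have : nbhs y (Q k z s) by apply: open_nbhs_nbhs; split => //; exact: open_Q.
rewrite /interior; apply: filterS => w zw /=; rewrite in_itv/= andbT.
by apply: lt_le_trans ht _; apply: ereal_sup_ubound; exists z, s.
Qed.

End local.

Section local_estimate.
Local Open Scope classical_set_scope.
Local Open Scope ring_scope.
Local Open Scope ereal_scope.
Context {R : realType} {n : nat}.
Hypothesis n0 : (0 < n)%N.
Implicit Types (f g : Rn R n -> \bar R) (x y : 'rV[R]_n).
Variables (k k' : cube_or_ball) (alpha p q lam mu : R).
Hypotheses (alpha0 : (0 <= alpha)%R) (p1 : (1 <= p)%R) (q1 : (1 <= q)%R).
Hypotheses (lam0 : (lam < 0)%R) (mu0 : (mu < 0)%R) (mulam : (mu = lam + alpha)%R).
Hypothesis qp : (q <= lam / mu * p)%R.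

Notation leb := (lebesgue R n).
Notation theta := (mu / lam)%R.

Let theta01 : (0 < theta <= 1)%R.
Proof.
apply/andP; split; first by rewrite nmulr_rgt0 ?invr_lt0.
by rewrite ler_ndivrMr// mul1r mulam lerDl.
Qed.

Let dil : R := (4 * n%:R ^+ 2)%R.

Let gt0_expR (x : R) : (0 < x)%R -> exists t, x = expR t.
Proof. by move=> x0; exists (ln x); rewrite lnK. Qed.

(** The total power of [rho] is [alpha + lam (1 - theta) = alpha + lam - mu = 0]. *)
Lemma hedberg_exponents (C rho s K v : R) :
  (0 < C -> 0 < rho -> 0 < s -> 0 < K -> 0 < v ->
  rho `^ alpha * ((C * (v * s `^ lam * K)) `^ theta *
    (C * (rho `^ lam * K)) `^ (1 - theta)) =
  C * (s `^ mu * (K * v `^ theta)))%R.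
Proof.
move=> /gt0_expR[c ->] /gt0_expR[d ->] /gt0_expR[e ->] /gt0_expR[f ->] /gt0_expR[g ->].
rewrite -!expRM -!expRD -!expRM -!expRD; congr expR; rewrite mulam; field.
by rewrite lt_eqF.
Qed.

(** A cube of radius less than [s] that meets [Q(x,s)] lies in the cube of radius
    [3 s] centred at [x], so its mean only sees this part of [f]. *)
Definition near_part f x s : Rn R n -> \bar R :=
  (abse \o f) \_ (Q Cube x (3 * s)%R).

(** Besides measurability, this is all that the local estimate uses about [f].  The
    factor [4 n^2] in the radius leaves room for the cubes of radius [r t] with
    centre within [3 r t] of the origin, after two passages between cubes and
    balls. *)
Definition morrey_growth f (K r : R) := forall t : R, (1 <= t)%R ->
  morrey_norm k p lam (Q0 k (dil * r * t)%R) f <= (t `^ (- mu) * K)%:E.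

(** Large values of [M_alpha f] on [Q(x,s)] can only come from sets of radius
    [rho < s].  For those the mean of [f] has the bound [rho ^ lam * K] from the
    growth hypothesis, and interpolating it with [v * s ^ lam * K] would keep the
    value below the threshold, if the maximal function of [near_part] at [y] were
    at most [v * s ^ lam * K]. *)
Lemma frac_maximal_superlevel : exists2 A : R, (0 < A)%R &
  forall f x y (K r s v : R), measurable_fun setT f -> (0 < K)%R ->
    (0 < s)%R -> (1 <= v)%R -> Q k x s `<=` Q0 k r -> Q k x s y ->
    morrey_growth f K r ->
    (A * (s `^ mu * K) * v `^ theta)%:E < frac_maximal k' alpha f y ->
    maximal_above (near_part f x s) (v * (s `^ lam * K)) y.
Proof.
have n1 : (1 <= n%:R :> R)%R by rewrite ler1n.
have [v' v'0 v'E] := lebesgue_Q_fin_gt0 (R := R) n0 k'.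
have [vc vc0 vcE] := lebesgue_Q_fin_gt0 (R := R) n0 Cube.
have [C C0 HC] := integral_cube_le_mean n0 k lam p1.
pose e := (- 1 + alpha / n%:R)%R.
pose C' := (C + vc)%R; have C'0 : (0 < C')%R by rewrite addr_gt0.
exists (v' `^ e * C')%R; first by rewrite mulr_gt0// powR_gt0.
move=> f x y K r s v mf K0 s0 v1 sub xy grow.
have [xr sr] := sub_Q0_center n0 s0 sub.
have r0 : (0 < r)%R by apply: lt_le_trans sr.
have v0 : (0 < v)%R by apply: lt_le_trans v1.
move=> /ereal_sup_gt[_ [y0 [rho [rho0 yy0 ->]]]].
have yx' : (`|y - x| < s)%R := Q_sub_cube xy.
have yy0' : (`|y - y0| < rho)%R := Q_sub_cube yy0.
have y0r : (`|y0| < r + s + rho)%R.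
  have -> : (y0 = (x + (y - x)) - (y - y0))%R
    by rewrite opprB (addrC x) subrK addrC subrK.
  apply: le_lt_trans (ler_normB _ _) _; apply: ltr_leD (ltW yy0') => //.
  by apply: le_lt_trans (ler_normD _ _) _; exact: ltrD.
set J := \int[leb]_(z in Q Cube y0 rho) `|f z|.
have J0 : 0 <= J by apply: integral_ge0.
(* The scale [t] of the growth hypothesis must be at least [rho / r] for the
   cube to fit. *)
have Jbound t : (1 <= t)%R -> (rho <= t * r)%R ->
    J <= (C * rho ^+ n * (rho `^ lam * (t `^ (- mu) * K)))%:E.
  move=> t1 rt; have t0 : (0 < t)%R by apply: lt_le_trans t1.
  apply: (HC _ _ _ (dil * r * t)%R) => //; last exact: grow.
    by rewrite mulr_gt0// powR_gt0.
  have rrt : (r <= t * r)%R by rewrite ler_peMl// ltW.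
  apply: (@le_trans _ _ (n%:R * (n%:R * (t * r) + n%:R * (3 * (t * r))))%R); last first.
    rewrite /dil expr2 le_eqVlt; apply/orP; left; apply/eqP; ring.
  rewrite ler_wpM2l// lerD//; first by rewrite ler_wpM2l.
  by rewrite (@le_trans _ _ (3 * (t * r))%R)// ?ler_peMl//; lra.
set W := leb (Q k' y0 rho) `^ e.
have WE : W = (v' `^ e * rho `^ (alpha - n%:R))%:E.
  rewrite /W v'E// poweR_EFin powRM ?exprn_ge0 ?(ltW rho0) ?(ltW v'0)//.
  rewrite -(powR_mulrn n (ltW rho0)) -powRrM /e mulrDr mulrCA divff ?mulr1;
    last by rewrite gt_eqF// (lt_le_trans _ n1).
  by rewrite mulrN1 (addrC alpha).
have Wint : W * \int[leb]_(z in Q k' y0 rho) `|f z| <=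
  (v' `^ e * rho `^ (alpha - n%:R))%:E * J.
  rewrite WE lee_wpmul2l ?lee_fin ?mulr_ge0 ?powR_ge0//.
  apply: ge0_subset_integral.
  - exact: measurable_Q.
  - exact: measurable_cube.
  - by apply: measurable_funTS; exact: measurableT_comp.
  - by move=> *; exact: abse_ge0.
  - exact: Q_sub_cube.
move=> /lt_le_trans /(_ Wint).
have Jfin : J \is a fin_num.
  rewrite ge0_fin_numE//.
  have t1 : (1 <= Num.max 1 (rho / r))%R by rewrite le_max lexx.
  apply: le_lt_trans (Jbound _ t1 _) (ltry _).
  by rewrite -ler_pdivrMr// le_max lexx orbT.
have rhon0 : (0 < rho ^+ n)%R by rewrite exprn_gt0.
have [a a0 JE] : exists2 a : R, (0 <= a)%R & J = (a * rho ^+ n)%:E.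
  exists (fine J / rho ^+ n)%R; first by rewrite divr_ge0 ?fine_ge0// ltW.
  by rewrite divfK ?gt_eqF// fineK.
have -> : (v' `^ e * rho `^ (alpha - n%:R))%:E * J = (v' `^ e * (rho `^ alpha * a))%:E.
  rewrite JE -EFinM -!mulrA; congr ((_ * _)%:E)%R.
  rewrite mulrCA [RHS]mulrC; congr (_ * _)%R.
  by rewrite -(powR_mulrn n (ltW rho0)) -powRD ?(gt_eqF rho0) ?implybT// subrK.
rewrite lte_fin -!mulrA ltr_pM2l ?powR_gt0// => hlt.
have abound t : (1 <= t)%R -> (rho <= t * r)%R ->
  (a <= C' * (rho `^ lam * (t `^ (- mu) * K)))%R.
  move=> t1 rt; have := Jbound t t1 rt; rewrite JE lee_fin mulrAC ler_pM2r//.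
  by move=> /le_trans; apply; rewrite ler_wpM2r ?mulr_ge0 ?powR_ge0 ?(ltW K0)// lerDl ltW.
have vth : (1 <= v `^ theta)%R.
  rewrite -(powRr0 v) ler_powR//; by case/andP: theta01 => /ltW.
have smuK0 : (0 < s `^ mu * K)%R by rewrite mulr_gt0 ?powR_gt0.
have [srho|rhos] := leP s rho.
  exfalso; move: hlt; apply/negP; rewrite -leNgt.
  (* With this scale, [rho / t] is the smaller of [rho] and [r], so at least [s]. *)
  pose t := Num.max 1%R (rho / r)%R.
  have t1 : (1 <= t)%R by rewrite le_max lexx.
  have t0 : (0 < t)%R by apply: lt_le_trans t1.
  have rt : (rho <= t * r)%R by rewrite -ler_pdivrMr// le_max lexx orbT.
  apply: le_trans (ler_wpM2l (powR_ge0 _ _) (abound t t1 rt)) _.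
  have -> : (rho `^ alpha * (C' * (rho `^ lam * (t `^ (- mu) * K))) =
    C' * ((rho / t) `^ mu * K))%R.
    rewrite mulrCA; congr (_ * _)%R; rewrite !mulrA; congr (_ * _)%R.
    rewrite -powRD ?(gt_eqF rho0) ?implybT// addrC -mulam powRM ?invr_ge0 ?(ltW rho0)
      ?(ltW t0)//.
    by rewrite -powR_inv1 ?(ltW t0)// -powRrM mulN1r.
  rewrite ler_wpM2l ?(ltW C'0)//; apply: (@le_trans _ _ (s `^ mu * K)%R); last first.
    by rewrite mulrA ler_peMr// ltW.
  rewrite ler_wpM2r ?(ltW K0)//; apply: le0_ger_powR => //; first exact: ltW.
  rewrite ler_pdivlMr// /t; case: (leP 1%R (rho / r)%R) => _; last by rewrite mulr1.
  by rewrite mulrCA ler_piMr ?(ltW rho0)// ler_pdivrMr// mul1r.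
exists y0, rho; split => //.
rewrite vcE// ltNge; apply/negP => hle.
move: hlt; apply/negP; rewrite -leNgt.
have nearE : \int[leb]_(z in Q Cube y0 rho) near_part f x s z = J.
  apply: eq_integral => z; rewrite inE => zy0; rewrite /near_part patchE.
  rewrite mem_set//=; apply: cube_sub_cube zy0.
  have -> : (y0 - x = (y - x) - (y - y0))%R by rewrite opprB [RHS]addrC addrA subrK.
  rewrite -lerBrDr; apply: le_trans (ler_normB _ _) _; lra.
move: hle; rewrite nearE JE -EFinM lee_fin [leRHS]mulrA ler_pM2r// => hle.
have a1 : (a <= C' * (v * s `^ lam * K))%R.
  apply: le_trans hle _; rewrite mulrC -(mulrA v); apply: ler_wpM2r.
    by apply: mulr_ge0; rewrite ?(ltW v0)// mulr_ge0 ?powR_ge0 ?(ltW K0).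
  by rewrite lerDr ltW.
have a2 : (a <= C' * (rho `^ lam * K))%R.
  have := abound 1%R (lexx _); rewrite mul1r powR1 mul1r; apply.
  exact: ltW (lt_le_trans rhos sr).
have := le_powR_interpolation _ a0 a1 a2 => /(_ theta).
case/andP: theta01 => th0 th1; rewrite (ltW th0) th1 => /(_ isT) ha.
apply: le_trans (ler_wpM2l (powR_ge0 _ _) ha) _.
by rewrite hedberg_exponents.
Qed.

Lemma near_part_ge0 f x s z : 0 <= near_part f x s z.
Proof. by rewrite /near_part patchE; case: ifP => _ //=; exact: abse_ge0. Qed.

Lemma measurable_near_part f x s : measurable_fun setT f ->
  measurable_fun setT (near_part f x s).
Proof.
move=> mf; apply/(measurable_restrictT _ _).1; first exact: measurable_cube.
by apply: measurable_funTS; exact: measurableT_comp.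
Qed.

Lemma integral_near_part : exists2 C : R, (0 < C)%R &
  forall f x (K r s : R), measurable_fun setT f -> (0 < K)%R ->
    (0 < s)%R -> Q k x s `<=` Q0 k r -> morrey_growth f K r ->
    \int[leb]_z (near_part f x s z `^ p) <= (C * s ^+ n * (s `^ lam * K) `^ p)%:E.
Proof.
have n1 : (1 <= n%:R :> R)%R by rewrite ler1n.
have p0 : (0 < p)%R by apply: lt_le_trans p1.
have [C C0 HC] := integral_cube_le_morrey n0 k lam p0.
exists (C * 3 ^+ n * (3 `^ lam) `^ p)%R.
  by rewrite !mulr_gt0 ?exprn_gt0 ?powR_gt0.
move=> f x K r s mf K0 s0 sub grow.
have [xr sr] := sub_Q0_center n0 s0 sub.
have -> : \int[leb]_z (near_part f x s z `^ p) =
    \int[leb]_(z in Q Cube x (3 * s)) (`|f z| `^ p).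
  rewrite [RHS]integral_mkcond; apply: eq_integral => z _.
  by rewrite /near_part !patchE; case: ifP => //= _; rewrite powR0 ?gt_eqF.
have -> : (C * 3 ^+ n * (3 `^ lam) `^ p * s ^+ n * (s `^ lam * K) `^ p =
    C * (3 * s) ^+ n * ((3 * s) `^ lam * K) `^ p)%R.
  rewrite exprMn (powRM _ _ (ltW s0))// -(mulrA (3 `^ lam)%R).
  rewrite (@powRM _ (3 `^ lam)%R) ?mulr_ge0 ?powR_ge0 ?(ltW K0)//; ring.
apply: (HC _ _ _ (dil * r * 1)%R) => //; [exact: ltW|by rewrite mulr_gt0| |].
  have r0 : (0 < r)%R by apply: lt_le_trans sr.
  apply: (@le_trans _ _ (n%:R * (n%:R * (3 * r) + n%:R * r))%R); last first.
    by rewrite /dil expr2 le_eqVlt; apply/orP; left; apply/eqP; ring.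
  rewrite ler_wpM2l// lerD//; first by rewrite ler_wpM2l// ler_wpM2l.
  by rewrite (le_trans (ltW xr))// ler_peMl// ltW.
by apply: le_trans (grow _ (lexx _)) _; rewrite powR1 mul1r.
Qed.

Let qtheta : (q * theta <= p)%R.
Proof.
have -> : p = (lam / mu * p * theta)%R by field; rewrite !lt_eqF.
by apply: ler_wpM2r => //; case/andP: theta01 => /ltW.
Qed.

Let q0 : (0 < q)%R. Proof. exact: lt_le_trans q1. Qed.

(** If [M] lies between the levels of index [j] and [j.+1], then the term of index
    [j] alone dominates [M ^ q], because [q * theta <= p]; if [M] is infinite,
    every term is present and they are unbounded. *)
Lemma dyadic_level_bound (D : R) (M : \bar R) (S : nat -> bool) :
  (0 < D)%R -> 0 <= M ->
  (forall j, (D * (2 ^+ j) `^ theta)%:E < M -> S j) ->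
  M `^ q <= (D `^ q)%:E +
    \sum_(j <oo) (D `^ q * (2 `^ p) ^+ j.+1 * (S j)%:R)%:E.
Proof.
move=> D0 M0 HS; case/andP: theta01 => th0 th1.
set F := fun j => (D `^ q * (2 `^ p) ^+ j.+1 * (S j)%:R)%:E.
have F0 j : 0 <= F j by rewrite lee_fin !mulr_ge0 ?powR_ge0 ?exprn_ge0 ?powR_ge0.
have step j : ((D * (2 ^+ j.+1) `^ theta) `^ q <= D `^ q * (2 `^ p) ^+ j.+1)%R.
  rewrite powRM ?powR_ge0 ?(ltW D0)// ler_wpM2l ?powR_ge0//.
  rewrite -powRrM powR_exprn//.
  by rewrite ler_powR ?exprn_ege1 ?ler1n// mulrC.
have [MD|DM] := leP M D%:E.
  have : M `^ q <= (D `^ q)%:E.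
    rewrite -poweR_EFin; apply: gt0_ler_poweR => //;
      rewrite ?in_itv/= ?leey ?andbT// ?(ltW q0)//.
    by rewrite lee_fin ltW.
  move=> /le_trans; apply; apply: leeDl; apply: nneseries_ge0 => j _ _; exact: F0.
case: M M0 HS DM => [M||]// M0 HS DM.
- have D1 : (0 < M / D)%R by rewrite divr_gt0// -lte_fin (lt_trans _ DM)// lte_fin.
  have [m0 hm0] := powR_infty_bound th0 D1.
  pose P m := (M <= D * (2 ^+ m) `^ theta)%R.
  have exP : exists m, P m by exists m0; rewrite /P mulrC -ler_pdivrMr.
  have [[|m]] := ex_minnP exP.
    rewrite /P expr0 powR1 mulr1 => MD; move: DM; rewrite lte_fin => /lt_le_trans/(_ MD).
    by rewrite ltxx.
  move=> Pm minm; have Sm : S m.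
    apply: HS; rewrite lte_fin ltNge; apply/negP => Pm'.
    by have := minm m Pm'; rewrite ltnn.
  apply: (@le_trans _ _ (F m)).
    rewrite poweR_EFin lee_fin Sm mulr1; apply: le_trans (step m).
    apply: ge0_ler_powR => //; rewrite ?nnegrE ?(ltW q0)//.
    by rewrite mulr_ge0 ?powR_ge0 ?(ltW D0).
  apply: le_trans (nneseries_ge_term m F0) _.
  by rewrite leeDr// lee_fin powR_ge0.
- suff -> : \sum_(j <oo) F j = +oo by rewrite addey// leey.
  apply/eqyP => e e0.
  have Dq : (0 < D `^ q)%R by rewrite powR_gt0.
  have p0 : (0 < p)%R by apply: lt_le_trans p1.
  have [m hm] := @powR_infty_bound R p (e / D `^ q)%R p0 (divr_gt0 e0 Dq).
  apply: (@le_trans _ _ (F m)); last exact: nneseries_ge_term.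
  rewrite lee_fin HS ?ltry// mulr1 mulrC -ler_pdivrMr//.
  apply: le_trans hm _; rewrite powR_exprn//.
  by apply: ge0_ler_powR;
    rewrite ?nnegrE ?exprn_ge0 ?(ltW p0)// exprS ler_peMl ?exprn_ge0// ler1n.
Qed.

(** Integrating the dyadic decomposition of [M_alpha f] over [Q(x,s)], the level
    sets are summed by the strong type inequality; the total is at most [E * D ^ q]
    times the measure of [Q(x,s)], where [D] is the lowest level. *)
Lemma morrey_frac_maximal : (1 < p)%R -> exists2 C : R, (0 < C)%R &
  forall f (K r : R), measurable_fun setT f -> (0 < K)%R -> morrey_growth f K r ->
    morrey_norm k q mu (Q0 k r) (frac_maximal k' alpha f) <= (C * K)%:E.
Proof.
move=> lt1p.
have [A A0 HA] := frac_maximal_superlevel.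
have [C5 C50 HC5] := strong_type n0 lt1p.
have [C6 C60 HC6] := integral_near_part.
have [v v0 vE] := lebesgue_Q_fin_gt0 (R := R) n0 k.
pose E := (1 + 2 `^ p * C5 * C6 / v)%R.
have E0 : (0 < E)%R by rewrite ltr_wpDr// divr_ge0 ?mulr_ge0 ?powR_ge0// ltW.
exists (A * E `^ q^-1)%R; first by rewrite mulr_gt0// powR_gt0.
move=> f K r mf K0 grow; apply: ge_ereal_sup => _ [x [s [s0 sub ->]]].
have V0 : (0 < v * s ^+ n)%R by rewrite mulr_gt0 ?exprn_gt0.
have smu0 : (0 < s `^ mu)%R by rewrite powR_gt0.
have CK0 : (0 <= A * E `^ q^-1 * K)%R by rewrite !mulr_ge0 ?powR_ge0 ?ltW.
rewrite vE// normalized_mean_leP//; last by apply: integral_ge0 => *; exact: poweR_ge0.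
set g := near_part f x s; pose B := (s `^ lam * K)%R; pose D := (A * (s `^ mu * K))%R.
have B0 : (0 < B)%R by rewrite mulr_gt0 ?powR_gt0.
have D0 : (0 < D)%R by rewrite !mulr_gt0.
have Dq0 : (0 <= D `^ q)%R by exact: powR_ge0.
pose S j := maximal_above g (2 ^+ j * B).
have mS j : measurable (S j) by exact: measurable_maximal_above.
have mQ : measurable (Q k x s : set (Rn R n)) by exact: measurable_Q.
pose c j := (D `^ q * (2 `^ p) ^+ j.+1)%R.
have c0 j : (0 <= c j)%R by rewrite mulr_ge0 ?exprn_ge0 ?powR_ge0.
pose F j (y : Rn R n) := (c j)%:E * (\1_(S j) y)%:E.
have F0 j y : 0 <= F j y by rewrite mule_ge0 ?lee_fin.
have mI j : measurable_fun (Q k x s : set (Rn R n)) (fun y => (\1_(S j) y)%:E : \bar R).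
  by apply/measurable_EFinP; exact: measurable_indic.
have mF j : measurable_fun (Q k x s : set (Rn R n)) (F j) by exact: measurable_funeM.
have mG : measurable_fun (Q k x s : set (Rn R n)) (fun y => \sum_(j <oo) F j y).
  exact: ge0_emeasurable_sum.
have pointwise y : Q k x s y ->
    `|frac_maximal k' alpha f y| `^ q <= (D `^ q)%:E + \sum_(j <oo) F j y.
  move=> xy; rewrite gee0_abs ?frac_maximal_ge0//.
  have FE : \sum_(j <oo) F j y =
      \sum_(j <oo) (D `^ q * (2 `^ p) ^+ j.+1 * (y \in S j)%:R)%:E.
    by apply: eq_eseriesr => j _; rewrite /F /c -EFinM indicE.
  rewrite FE; apply: dyadic_level_bound => //; first exact: frac_maximal_ge0.
  move=> j hj; rewrite inE; apply: (HA f x y K r s (2 ^+ j)%R) => //.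
  by rewrite exprn_ege1// ler1n.
apply: (@le_trans _ _ (\int[leb]_(y in Q k x s) ((D `^ q)%:E + \sum_(j <oo) F j y))).
  apply: ge0_le_integral.
  - exact: mQ.
  - by move=> *; exact: poweR_ge0.
  - by apply: measurable_abse_poweR; exact: measurable_frac_maximal.
  - by apply: emeasurable_funD => //; exact: measurable_cst.
  - exact: pointwise.
rewrite ge0_integralD; last 5 first.
- exact: mQ.
- by move=> *; rewrite lee_fin.
- exact: measurable_cst.
- by move=> *; apply: nneseries_ge0 => *; exact: F0.
- exact: mG.
rewrite integral_cst// (integral_nneseries leb mQ mF); last by move=> *; exact: F0.
rewrite [X in _ * X + _](_ : _ = (v * s ^+ n)%:E); last exact: vE.
have sumle : \sum_(j <oo) \int[leb]_(y in Q k x s) F j y <=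
    (D `^ q * 2 `^ p)%:E * \sum_(j <oo) (((2 `^ p) ^+ j)%:E * leb (S j)).
  rewrite -nneseriesZl; last by move=> j _;
    rewrite mule_ge0// lee_fin exprn_ge0 ?powR_ge0.
  apply: lee_nneseries => [j _ _|j _]; first by apply: integral_ge0 => *; exact: F0.
  rewrite (ge0_integralZl leb mQ (mI j)); last 2 first.
    by move=> *; rewrite lee_fin.
    by rewrite lee_fin.
  rewrite integral_indic// muleA -EFinM -mulrA -exprS lee_wpmul2l ?lee_fin//.
  by apply: le_measure; rewrite ?inE//; exact: measurableI.
have g0 y : 0 <= g y by exact: near_part_ge0.
have mg : measurable_fun setT g by exact: measurable_near_part.
have := HC5 g B g0 mg B0; rewrite -/S => H5.
have := HC6 f x K r s mf K0 s0 sub grow; rewrite -/g -/B => H6.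
apply: (@le_trans _ _ (((D `^ q) * (v * s ^+ n))%:E + (D `^ q * 2 `^ p)%:E *
   ((C5 / B `^ p)%:E * (C6 * s ^+ n * B `^ p)%:E))).
  rewrite EFinM leeD2l//; apply: le_trans sumle _.
  apply: lee_wpmul2l; first by rewrite lee_fin mulr_ge0 ?powR_ge0.
  apply: le_trans H5 _; apply: lee_wpmul2l => //.
  by rewrite lee_fin divr_ge0 ?powR_ge0// ltW.
rewrite -!EFinM -EFinD lee_fin.
have -> : (s `^ mu * (A * E `^ q^-1 * K) = D * E `^ q^-1)%R by rewrite /D; ring.
rewrite powRM ?powR_ge0 ?(ltW D0)// -powRrM mulVf ?(gt_eqF q0)// powRr1 ?(ltW E0)//.
rewrite le_eqVlt /E; apply/orP; left; apply/eqP; field.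
by rewrite !gt_eqF// powR_gt0.
Qed.

(** Below the threshold [D] the trivial bound by the measure of [Q(x,s)] is enough.
    Above it, writing the level as [D * w ^ theta], the weak type inequality gains
    a factor [1 / w], which compensates [w ^ (q * theta)] since [q * theta <= 1]. *)
Lemma weak_morrey_frac_maximal : p = 1%R -> exists2 C : R, (0 < C)%R &
  forall f (K r : R), measurable_fun setT f -> (0 < K)%R -> morrey_growth f K r ->
    weak_morrey_norm k q mu (Q0 k r) (frac_maximal k' alpha f) <= (C * K)%:E.
Proof.
move=> p1E.
have [A A0 HA] := frac_maximal_superlevel.
have [C6 C60 HC6] := integral_near_part.
have [v v0 vE] := lebesgue_Q_fin_gt0 (R := R) n0 k.
pose E := (1 + 3 ^+ n * C6 / v)%R.
have E1 : (1 <= E)%R by rewrite ler_wpDr// divr_ge0 ?mulr_ge0 ?exprn_ge0// ltW.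
have E0 : (0 < E)%R by apply: lt_le_trans E1.
exists (A * E `^ q^-1)%R; first by rewrite mulr_gt0// powR_gt0.
move=> f K r mf K0 grow; apply: ge_ereal_sup => _ [x [s [s0 sub ->]]].
have V0 : (0 < v * s ^+ n)%R by rewrite mulr_gt0 ?exprn_gt0.
have smu0 : (0 < s `^ mu)%R by rewrite powR_gt0.
have CK0 : (0 <= A * E `^ q^-1 * K)%R by rewrite !mulr_ge0 ?powR_ge0 ?ltW.
rewrite vE// normalized_mean_leP//; last first.
  apply: (@le_trans _ _ ((1 `^ q)%R%:E *
      leb (Q k x s `&` [set z | 1%:E < `|frac_maximal k' alpha f z|]))).
    by apply: mule_ge0; rewrite ?lee_fin ?powR_ge0.
  by apply: ereal_sup_ubound; exists 1%R => /=.
set g := near_part f x s; pose B := (s `^ lam * K)%R; pose D := (A * (s `^ mu * K))%R.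
have B0 : (0 < B)%R by rewrite mulr_gt0 ?powR_gt0.
have D0 : (0 < D)%R by rewrite !mulr_gt0.
have -> : (s `^ mu * (A * E `^ q^-1 * K) = D * E `^ q^-1)%R by rewrite /D; ring.
rewrite powRM ?powR_ge0 ?(ltW D0)// -powRrM mulVf ?(gt_eqF q0)// powRr1 ?(ltW E0)//.
have mQ : measurable (Q k x s : set (Rn R n)) by exact: measurable_Q.
have mM : measurable_fun setT (fun z => `|frac_maximal k' alpha f z|).
  exact: measurableT_comp (measurable_frac_maximal _ _ _).
have mMQ : measurable_fun (Q k x s :
  set (Rn R n)) (fun z => `|frac_maximal k' alpha f z|).
  exact: measurable_funTS.
have mL (t : R) : measurable (Q k x s `&` [set z | t%:E < `|frac_maximal k' alpha f z|]
  : set (Rn R n)).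
  exact: (emeasurable_fun_o_infty mQ mMQ).
apply: ge_ereal_sup => _ [t /= t0 <-].
have [tD|Dt] := leP t D.
  apply: (@le_trans _ _ ((D `^ q)%:E * (v * s ^+ n)%:E)).
    apply: lee_pmul => //; rewrite ?lee_fin ?powR_ge0 ?measure_ge0//.
    - exact: outer_measure_ge0.
    - by apply: ge0_ler_powR; rewrite ?nnegrE ?(ltW q0) ?(ltW D0) ?(ltW t0).
    - by rewrite -(vE x s s0); apply: le_measure; rewrite ?inE.
  by rewrite -EFinM lee_fin mulrC ler_wpM2l ?(ltW V0)// ler_peMr ?powR_ge0.
case/andP: theta01 => th0 th1.
have tD1 : (1 <= t / D)%R by rewrite ler_pdivlMr// mul1r ltW.
pose w := ((t / D) `^ theta^-1)%R.
have w1 : (1 <= w)%R by rewrite -(powRr0 (t / D)) /w ler_powR// invr_ge0 ltW.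
have w0 : (0 < w)%R by apply: lt_le_trans w1.
have tE : (t = D * w `^ theta)%R.
  by rewrite /w -powRrM mulVf ?gt_eqF// powRr1 ?divr_ge0 ?(ltW t0) ?(ltW D0)// mulrC
    divfK ?gt_eqF.
have g0 y : 0 <= g y by exact: near_part_ge0.
have mg : measurable_fun setT g by exact: measurable_near_part.
have wB0 : (0 < w * B)%R by rewrite mulr_gt0.
have := weak_type11 n0 g0 mg (ltW wB0).
have := HC6 f x K r s mf K0 s0 sub grow; rewrite -/g -/B p1E.
under eq_integral do rewrite (poweRe1 (g0 _)).
rewrite powRr1 ?(ltW B0)// => H6 H11.
have Hm : leb (Q k x s `&` [set z | t%:E < `|frac_maximal k' alpha f z|]) <=
    (3 ^+ n * (C6 * s ^+ n * B) / (w * B))%:E.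
  rewrite mulrC EFinM lee_pdivlMl//.
  apply: (@le_trans _ _ ((3 ^+ n)%:E * \int[leb]_y g y)); last first.
    by rewrite (EFinM (3 ^+ n)%R) lee_wpmul2l// lee_fin exprn_ge0.
  apply: le_trans H11; rewrite lee_wpmul2l ?lee_fin ?(ltW wB0)//.
  apply: le_measure; rewrite ?inE//; first exact: measurable_maximal_above.
  move=> y [xy /=]; rewrite gee0_abs ?frac_maximal_ge0// tE => hy.
  exact: (HA f x y K r s w).
apply: (@le_trans _ _ ((t `^ q)%:E * (3 ^+ n * (C6 * s ^+ n * B) / (w * B))%:E)).
  by rewrite lee_wpmul2l// lee_fin powR_ge0.
have tq : (t `^ q <= D `^ q * w)%R.
  rewrite tE powRM ?powR_ge0 ?(ltW D0)// ler_wpM2l ?powR_ge0//.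
  rewrite -powRrM -[leRHS](powRr1 (ltW w0)) ler_powR// mulrC -p1E//.
rewrite -EFinM lee_fin.
apply: (@le_trans _ _ (D `^ q * w * (3 ^+ n * (C6 * s ^+ n * B) / (w * B)))%R).
  apply: ler_wpM2r => //; apply: divr_ge0; last exact: ltW.
  by rewrite mulr_ge0 ?exprn_ge0// mulr_ge0 ?(ltW B0)// mulr_ge0 ?exprn_ge0 ?(ltW s0)
    ?(ltW C60).
have -> : (D `^ q * w * (3 ^+ n * (C6 * s ^+ n * B) / (w * B)) =
   v * s ^+ n * (D `^ q * (3 ^+ n * C6 / v)))%R.
  by field; rewrite !gt_eqF.
rewrite ler_wpM2l ?(ltW V0)// ler_wpM2l ?powR_ge0// /E lerDr//.
Qed.

End local_estimate.

(** * Dilations and the measure dr/r *)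

Section haar_scaling.
Local Open Scope classical_set_scope.
Local Open Scope ring_scope.
Local Open Scope ereal_scope.
Context {R : realType}.
Notation MR := (measurableTypeR R).

Let scale (a : R) : MR -> MR := fun r => (a * r)%R.

Let mscale_fun a : measurable_fun setT (scale a).
Proof. exact: mulrl_measurable. Qed.

Let scale_preimage (a : R) (A : set MR) : measurable A -> measurable (scale a @^-1` A).
Proof. by move=> mA; rewrite -[X in measurable X]setTI; exact: (@mscale_fun a). Qed.

Let pf (a : R) : {measure set MR -> \bar R} :=
  @measure_function_pushforward__canonical__measure_function_Measure _ _ _ _ _
    lebesgue_measure (scale a) (mscale_fun a).
(** Both sides are measures in [A], so intervals suffice. *)
Lemma lebesgue_measure_scale (a : R) (A : set MR) : (0 < a)%R -> measurable A ->
  pf a A = (a^-1)%:E * lebesgue_measure A.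
Proof.
move=> a0 mA.
have a1 : (0 <= a)%R by exact: ltW.
suff -> : lebesgue_measure A = mscale (NngNum a1) (pf a) A.
  by rewrite /mscale/= muleA -EFinM mulVf ?gt_eqF// mul1e.
apply: lebesgue_measure_unique => //= _ [[x y]] _ <-.
rewrite /mscale/= /pushforward/=.
have -> : scale a @^-1` `]x, y]%classic = `](x / a)%R, (y / a)%R]%classic.
  by apply/seteqP; split => r /=;
    rewrite !in_itv/= /scale (mulrC a) ltr_pdivrMr// ler_pdivlMr.
rewrite !lebesgue_measure_itv/= !lte_fin ltr_pM2r ?invr_gt0//.
case: ifP => _; rewrite ?mule0// -!EFinB -EFinM; congr (_%:E).
by rewrite -mulrBl mulrC divfK ?gt_eqF.
Qed.

Let m_inv : measurable_fun (`]0%R, +oo[%classic : set MR) (fun r : MR => (r^-1)%:E).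
Proof.
apply/measurable_EFinP; apply: open_continuous_measurable_fun; first exact: interval_open.
move=> r; rewrite inE/= in_itv/= andbT => r0.
by apply: inv_continuous; rewrite gt_eqF.
Qed.

Lemma haar_scale (a : R) (A : set MR) : (0 < a)%R -> measurable A ->
  haar ([set r | A (a * r)%R] : set MR) = haar A.
Proof.
move=> a0 mA.
pose D := A `&` `]0%R, +oo[%classic.
have mD : measurable D by apply: measurableI => //; exact: measurable_itv.
have mf : measurable_fun D (fun r : MR => (r^-1)%:E).
  by apply: measurable_funS m_inv => [|r []//]; exact: measurable_itv.
have f0 r : D r -> 0 <= (r^-1)%:E.
  by move=> [_]; rewrite /= in_itv/= andbT => r0; rewrite lee_fin invr_ge0 ltW.
rewrite /haar -/D.
have g0 r : D r -> 0 <= a%:E * (r^-1)%:E.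
  by move=> Dr; apply: mule_ge0; [rewrite lee_fin ltW|exact: f0].
have mg : measurable_fun D (fun r : MR => a%:E * (r^-1)%:E) by exact: measurable_funeM.
transitivity (\int[pf a]_(r in D) (a%:E * (r^-1)%:E)).
  rewrite (ge0_integral_pushforward (mscale_fun a) lebesgue_measure mD mg); last first.
    by move=> r; rewrite inE; exact: g0.
  rewrite (_ : scale a @^-1` D = [set r | A (a * r)%R] `&` `]0%R, +oo[%classic);
    last first.
    apply/seteqP; split => r [Ar]; rewrite /= in_itv/= andbT => r0; split => //=.
      by rewrite in_itv/= andbT -(pmulr_rgt0 _ a0).
    by rewrite in_itv/= andbT pmulr_rgt0.
  apply: eq_integral => r /=; rewrite inE => -[_]; rewrite /= in_itv/= andbT => r0.
  by rewrite -EFinM /scale invfM mulrA divff ?mul1r// gt_eqF.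
have ai0 : (0 <= a^-1)%R by rewrite invr_ge0 ltW.
rewrite (eq_measure_integral (mscale (NngNum ai0) lebesgue_measure)); last first.
  by move=> B mB _; rewrite lebesgue_measure_scale.
rewrite ge0_integral_mscale// ge0_integralZl//; last by rewrite lee_fin ltW.
by rewrite muleA -EFinM mulVf ?gt_eqF// mul1e.
Qed.

End haar_scaling.

Section Lnorm_nonmeasurable.
Local Open Scope classical_set_scope.
Local Open Scope ring_scope.
Local Open Scope ereal_scope.
Context d {T : measurableType d} {R : realType}.
Variables (mu : {measure set T -> \bar R}) (D : set T).
Hypotheses (mD : measurable D) (muD : mu (~` D) = 0).
Implicit Types F G : T -> \bar R.

Import HBNNSimple.

(** The integral of an arbitrary nonnegative function is the supremum of the
    integrals of the simple functions below it, and multiplying a simple function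
    by the indicator of [D] does not change its integral. *)
Lemma le_integral_conull F G : (forall x, 0 <= F x) -> (forall x, 0 <= G x) ->
  (forall x, D x -> F x <= G x) -> \int[mu]_x F x <= \int[mu]_x G x.
Proof.
move=> F0 G0 FG; rewrite !ge0_integralTE//.
apply: ge_ereal_sup => _ [h /= hF <-].
pose hD := mul_nnsfun h (indic_nnsfun R mD).
have -> : sintegral mu h = sintegral mu hD.
  rewrite -!integralT_nnsfun; apply: ge0_ae_eq_integral.
  - exact: measurableT.
  - exact/measurable_EFinP.
  - exact/measurable_EFinP.
  - by move=> x _; rewrite lee_fin.
  - by move=> x _; rewrite lee_fin.
  exists (~` D); split => //; first exact: measurableC.
  move=> x /= hx Dx; apply: hx => _.
  by rewrite /hD/= mindicE mem_set// mulr1.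
apply: ereal_sup_ubound; exists hD => //= x.
rewrite /hD/= mindicE; case: (boolP (x \in D)) => [|_]; last by rewrite mulr0.
by rewrite inE => Dx; rewrite mulr1; apply: le_trans (hF x) (FG x Dx).
Qed.

Lemma le_Lnorm_conull (u : \bar R) F G : 0 < u ->
  (forall x, D x -> `|F x| <= `|G x|) -> Lnorm mu u F <= Lnorm mu u G.
Proof.
rewrite unlock; case: u => [u||]//.
- rewrite lte_fin => u0 FG; apply: gt0_ler_poweR; first by rewrite invr_ge0 ltW.
  + by rewrite in_itv/= leey andbT integral_ge0// => *; exact: poweR_ge0.
  + by rewrite in_itv/= leey andbT integral_ge0// => *; exact: poweR_ge0.
  apply: le_integral_conull => [x|x|x Dx]; [exact: poweR_ge0..|].
  by apply: gt0_ler_poweR; rewrite ?in_itv/= ?leey ?andbT ?(ltW u0) ?FG.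
- move=> _ FG; case: ifP => // _; apply: le_ess_sup.
  exists (~` D); split => //; first exact: measurableC.
  by move=> x /= h Dx; apply: h; exact: FG.
Qed.

End Lnorm_nonmeasurable.

Section dilations.
Local Open Scope classical_set_scope.
Local Open Scope ring_scope.
Local Open Scope ereal_scope.
Context {R : realType}.
Variable I : interval R.
Hypothesis Igt0 : forall r, r \in I -> (0 < r)%R.
Hypothesis Iup : forall r a, r \in I -> (1 <= a)%R -> (a * r)%R \in I.
Notation MR := (measurableTypeR R).
Notation m := (mrestr (@haar R) (measurable_itv I)).

Let mI : measurable ([set` I] : set MR). Proof. exact: measurable_itv. Qed.

Lemma mrestr_haar_conull : m (~` [set` I]) = 0.
Proof. by rewrite /mrestr setICl measure0. Qed.

Lemma le_Lnorm_haar (u : \bar R) (F G : MR -> \bar R) : 0 < u ->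
  (forall r, r \in I -> `|F r| <= `|G r|) -> Lnorm m u F <= Lnorm m u G.
Proof. by move=> u0 FG; apply: (le_Lnorm_conull mI mrestr_haar_conull u0). Qed.

Let mscale_fun (a : R) : measurable_fun setT (fun r : MR => a * r : MR)%R.
Proof. exact: mulrl_measurable. Qed.

(** The range of integration is mapped into itself by dilations of ratio at least
    1, so that the invariance of [dr/r] survives as an inequality. *)
Lemma mrestr_haar_dilate (a : R) (A : set MR) : (1 <= a)%R -> measurable A ->
  m ([set r | A (a * r)%R]) <= m A.
Proof.
move=> a1 mA; have a0 : (0 < a)%R by apply: lt_le_trans a1.
have mpre (B : set MR) : measurable B -> measurable ([set r | B (a * r)%R] : set MR).
  move=> mB; have := @mscale_fun a measurableT B mB; rewrite setTI; exact.
rewrite /mrestr -(@haar_scale R a (A `&` [set` I]))//; last exact: measurableI.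
apply: le_measure; rewrite ?inE.
- by apply: measurableI => //; exact: mpre.
- by apply: mpre; exact: measurableI.
- by move=> r [Ar /= Ir]; split => //=; exact: Iup.
Qed.

Lemma integral_dilate (a : R) (F : MR -> \bar R) : (1 <= a)%R ->
  measurable_fun setT F -> (forall r, 0 <= F r) ->
  \int[m]_r F (a * r)%R <= \int[m]_r F r.
Proof.
move=> a1 mF F0.
have := @ge0_integral_pushforward _ _ MR MR R _ (@mscale_fun a) m setT F measurableT mF.
rewrite preimage_setT => <- //.
apply: ge0_le_measure_integral => // A mA.
exact: mrestr_haar_dilate.
Qed.

Lemma nneseries_geometric_le (rho : R) (x : \bar R) : (0 < rho < 1)%R -> 0 <= x ->
  \sum_(j <oo) ((rho ^+ j)%:E * x) <= ((1 - rho)^-1)%:E * x.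
Proof.
move=> /andP[r0 r1] x0; have rj j : (0 <= rho ^+ j)%R by rewrite exprn_ge0// ltW.
apply: nneseries_le_bound => [j|k]; first by apply: mule_ge0; rewrite ?lee_fin.
rewrite -ge0_sume_distrl => [|j _]; last by rewrite lee_fin.
rewrite lee_wpmul2r// sumEFin lee_fin -div1r ler_pdivlMr ?subr_gt0//.
have -> : (1 - rho = - (rho - 1))%R by rewrite opprB.
by rewrite big_mkord mulrN mulrC -subrX1 opprB gerBl.
Qed.

(** For finite [u] the supremum is at most the [l^u] norm of the sequence, even for
    [u < 1]; for infinite [u] the term [j = 0] has the largest bound. *)
Lemma Lnorm_dilation_sup (u : \bar R) (rho c : R) : 0 < u -> (0 < rho < 1)%R ->
  (0 < c)%R ->
  exists2 C : R, (0 < C)%R & forall (a : nat -> R) (G P : MR -> \bar R),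
    (forall j, 1 <= a j)%R -> measurable_fun setT G -> (forall r, 0 <= G r) ->
    (forall r, r \in I ->
      `|P r| <= c%:E * ereal_sup (range (fun j => (rho ^+ j)%:E * G (a j * r)%R))) ->
    Lnorm m u P <= C%:E * Lnorm m u G.
Proof.
move=> + /andP[r0 r1] c0; case: u => [u||]//.
- rewrite lte_fin => u0.
  have ru : (0 < rho `^ u < 1)%R.
    rewrite powR_gt0//=; have := @gt0_ltr_powR R u u0 rho 1%R.
    by rewrite powR1 !nnegrE (ltW r0) ler01; apply.
  pose A := ((1 - rho `^ u)^-1)%R.
  have A0 : (0 < A)%R by rewrite invr_gt0 subr_gt0; case/andP: ru.
  exists (c * A `^ u^-1)%R; first by rewrite mulr_gt0 ?powR_gt0.
  move=> a G P a1 mG G0 HP; rewrite unlock.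
  pose F j (r : MR) := ((rho `^ u) ^+ j)%:E * G (a j * r)%R `^ u.
  have mGa j : measurable_fun setT (fun r : MR => G (a j * r)%R).
    exact: (measurableT_comp mG (@mscale_fun (a j))).
  have mGau j : measurable_fun setT (fun r : MR => G (a j * r)%R `^ u).
    exact: (measurableT_comp (measurable_poweR _)).
  have mF j : measurable_fun setT (F j) by exact: measurable_funeM.
  have F0 j r : 0 <= F j r.
    by apply: mule_ge0; rewrite ?poweR_ge0// lee_fin exprn_ge0// powR_ge0.
  have cu0 : (0 <= c `^ u)%R by exact: powR_ge0.
  have S0 r : 0 <= \sum_(j <oo) F j r by apply: nneseries_ge0 => *; exact: F0.
  have step r : r \in I -> `|P r| `^ u <= (c `^ u)%:E * \sum_(j <oo) F j r.
    move=> Ir.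
    have : `|P r| <= c%:E * (\sum_(j <oo) F j r) `^ u^-1.
      apply: le_trans (HP r Ir) _; apply: lee_wpmul2l; first by rewrite lee_fin ltW.
      apply: ge_ereal_sup => _ [j _ <-].
      have x0 : 0 <= (rho ^+ j)%:E * G (a j * r)%R by apply: mule_ge0;
        rewrite ?lee_fin ?exprn_ge0 ?(ltW r0).
      have xE : ((rho ^+ j)%:E * G (a j * r)%R) `^ u = F j r.
        by rewrite poweRM ?lee_fin ?exprn_ge0 ?(ltW r0)// poweR_EFin -powR_exprn ?(ltW
          r0).
      have <- : ((rho ^+ j)%:E * G (a j * r)%R) `^ u `^ u^-1 =
        (rho ^+ j)%:E * G (a j * r)%R.
        by rewrite -poweRrM divff ?gt_eqF// poweRe1.
      apply: gt0_ler_poweR;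
        rewrite ?in_itv/= ?leey ?andbT ?poweR_ge0 ?invr_ge0 ?(ltW u0)//.
      rewrite xE; exact: nneseries_ge_term.
    move=> /(gt0_ler_poweR (ltW u0)); rewrite !in_itv/= !leey !andbT abse_ge0.
    have c1 : 0 <= c%:E * (\sum_(j <oo) F j r) `^ u^-1.
      by apply: mule_ge0; rewrite ?poweR_ge0// lee_fin ltW.
    move=> /(_ isT c1) /le_trans; apply.
    by rewrite poweRM ?lee_fin ?(ltW c0) ?poweR_ge0// -poweRrM mulVf ?gt_eqF// poweRe1.
  have int_le : \int[m]_r (`|P r| `^ u) <= (c `^ u * A)%:E * \int[m]_r (`|G r| `^ u).
    apply: (@le_trans _ _ (\int[m]_r ((c `^ u)%:E * \sum_(j <oo) F j r))).
      apply: (le_integral_conull mI mrestr_haar_conull) => [r|r|r Ir].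
      + exact: poweR_ge0.
      + by apply: mule_ge0; rewrite ?lee_fin.
      + exact: step.
    have mS : measurable_fun setT (fun r => \sum_(j <oo) F j r).
      by apply: ge0_emeasurable_sum => // *; exact: F0.
    rewrite (ge0_integralZl m measurableT mS)// (integral_nneseries m measurableT mF)//.
    rewrite EFinM -muleA lee_wpmul2l ?lee_fin//.
    apply: (@le_trans _ _ (\sum_(j <oo) ((rho `^ u) ^+ j)%:E * \int[m]_r (`|G r| `^ u))).
      apply: lee_nneseries => [j _ _|j _]; first by apply: integral_ge0 => *; exact: F0.
      rewrite (ge0_integralZl m measurableT (mGau j))//; last 2 first.
        by move=> *; exact: poweR_ge0.
        by rewrite lee_fin exprn_ge0 ?powR_ge0.
      apply: lee_wpmul2l; first by rewrite lee_fin exprn_ge0 ?powR_ge0.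
      under [leRHS]eq_integral do rewrite (gee0_abs (G0 _)).
      apply: (@integral_dilate (a j) (fun r => G r `^ u)) => //.
        exact: (measurableT_comp (measurable_poweR _)).
      by move=> r; exact: poweR_ge0.
    apply: nneseries_geometric_le => //.
    by apply: integral_ge0 => *; exact: poweR_ge0.
  have I0 : 0 <= \int[m]_r (`|G r| `^ u) by apply: integral_ge0 => *; exact: poweR_ge0.
  have -> : (c * A `^ u^-1)%:E * (\int[m]_r (`|G r| `^ u)) `^ u^-1 =
      ((c `^ u * A)%:E * \int[m]_r (`|G r| `^ u)) `^ u^-1.
    rewrite poweRM ?lee_fin ?mulr_ge0 ?(ltW A0)//; congr (_ * _).
    rewrite poweR_EFin powRM ?(ltW A0)// -powRrM divff ?gt_eqF// powRr1 ?(ltW c0)//.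
  apply: gt0_ler_poweR; rewrite ?in_itv/= ?leey ?andbT ?invr_ge0 ?(ltW u0)//.
    by apply: integral_ge0 => *; exact: poweR_ge0.
  by apply: mule_ge0; rewrite ?lee_fin ?mulr_ge0 ?(ltW A0).
- move=> _; exists c => // a G P a1 mG G0 HP; rewrite unlock.
  case: ifP => mpos; last by rewrite mule0.
  apply/ess_supP.
  have dil j : \forall r \ae m, G (a j * r)%R <= ess_sup m (abse \o G).
    have [N [mN N0 subN]] := ess_sup_ge m (abse \o G).
    exists [set r | N (a j * r)%R]; split.
    - have := @mscale_fun (a j) measurableT N mN; rewrite setTI; exact.
    - apply/eqP; rewrite eq_le measure_ge0 andbT -N0.
      exact: mrestr_haar_dilate.
    move=> r /= h; apply: subN => /= h'; apply: h.
    by apply: le_trans h'; exact: lee_abs.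
  have inI : \forall r \ae m, r \in I.
    exists (~` [set` I]); split => //; first exact: measurableC.
    exact: mrestr_haar_conull.
  have := (ae_foralln (mu := m) dil).
  move: inI; apply: filterS2; first exact: (ae_filter_ringOfSetsType m).
  move=> r Ir Gr /=.
  apply: le_trans (HP r Ir) _; apply: lee_wpmul2l; first by rewrite lee_fin ltW.
  apply: ge_ereal_sup => _ [j _ <-].
  apply: (@le_trans _ _ (G (a j * r)%R)); last exact: Gr.
  rewrite -[leRHS]mul1e; apply: lee_wpmul2r => //.
  by rewrite lee_fin exprn_ile1// ltW.
Qed.

End dilations.

(** * The weight *)

Section tail.
Local Open Scope classical_set_scope.
Local Open Scope ring_scope.
Local Open Scope ereal_scope.
Context {R : realType}.
Notation MR := (measurableTypeR R).

(** The density [1/r] is at least [1 / (2 x)] on the interval [[x, 2 x]]. *)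
Lemma haar_ray_gt0 (x : R) : (0 < x)%R -> 0 < haar (`[x, +oo[%classic : set MR).
Proof.
move=> x0; pose J := `[x, (2 * x)%R]%classic : set MR.
have mJ : measurable J by exact: measurable_itv.
apply: (@lt_le_trans _ _ (\int[lebesgue_measure]_(r in J) (cst ((2 * x)^-1)%:E r))).
  rewrite integral_cst; last exact: mJ.
  rewrite /J /= lebesgue_measure_itv/= lte_fin.
  have -> : (x < 2 * x)%R by lra.
  by rewrite -EFinB -EFinM lte_fin mulr_gt0 ?invr_gt0 ?mulr_gt0//; lra.
have pos r : J r -> (0 < r)%R.
  by rewrite /J/= in_itv/= => /andP[xr _]; apply: lt_le_trans xr.
have minv (D : set MR) : D `<=` `]0%R, +oo[%classic ->
  measurable_fun D (fun r : MR => (r^-1)%:E).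
  move=> sub; apply: (measurable_funS _ sub); first exact: (@measurable_itv R).
  apply/measurable_EFinP; apply: open_continuous_measurable_fun;
    first exact: interval_open.
  move=> r; rewrite inE/= in_itv/= andbT => r0.
  by apply: inv_continuous; rewrite gt_eqF.
apply: (@le_trans _ _ (\int[lebesgue_measure]_(r in J) (r^-1)%:E)).
  apply: ge0_le_integral.
  - exact: mJ.
  - by move=> *; rewrite lee_fin invr_ge0 mulr_ge0// ltW.
  - exact: measurable_cst.
  - by apply: minv => r /pos r0; rewrite /= in_itv/= r0.
  - move=> r /[dup] Jr /pos r0; rewrite lee_fin lef_pV2 ?posrE ?mulr_gt0//.
    by move: Jr; rewrite /J/= in_itv/= => /andP[].
rewrite /haar; apply: ge0_subset_integral.
- exact: mJ.
- by apply: measurableI; exact: measurable_itv.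
- by apply: minv => r [].
- by move=> r [_]; rewrite /= in_itv/= andbT => r0; rewrite lee_fin invr_ge0 ltW.
- move=> r /[dup] Jr /pos r0; split; rewrite /= in_itv/= ?r0//.
  by move: Jr; rewrite /J/= in_itv/= => /andP[-> _].
Qed.

Variable I : interval R.
Hypothesis I1 : forall r, (1 <= r)%R -> r \in I.
Notation m := (mrestr (@haar R) (measurable_itv I)).

(** This turns finiteness of a norm into finiteness at every point, for functions
    that are infinite on a whole ray as soon as they are infinite at a point. *)
Lemma Lnorm_tail_infty (u : \bar R) (r0 : R) : 0 < u ->
  Lnorm m u (fun r : MR => if (r0 <= r)%R then +oo else 0) = +oo.
Proof.
pose T := `[r0, +oo[%classic : set MR.
have mT : measurable T by exact: measurable_itv.
have TE (r : MR) : (r \in T) = (r0 <= r)%R.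
  by apply/idP/idP; rewrite inE /T/= in_itv/= andbT.
have mTgt0 : 0 < m T.
  pose x := Num.max 1%R r0.
  have x1 : (1 <= x)%R by rewrite le_max lexx.
  apply: lt_le_trans (haar_ray_gt0 (lt_le_trans ltr01 x1)) _.
  rewrite /mrestr; apply: le_measure; rewrite ?inE.
  - exact: measurable_itv.
  - by apply: measurableI => //; exact: measurable_itv.
  - move=> r; rewrite /= in_itv/= andbT => xr; split.
      by rewrite /T/= in_itv/= andbT (le_trans _ xr)// le_max lexx orbT.
    by rewrite /=; apply: I1; exact: le_trans xr.
rewrite unlock; case: u => [u||]//.
- rewrite lte_fin => u0.
  have -> : \int[m]_r `|if (r0 <= r)%R then +oo else 0| `^ u =
      \int[m]_(r in T) (cst +oo r) :> \bar R.
    rewrite [RHS]integral_mkcond; apply: eq_integral => r _.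
    rewrite patchE TE; case: ifP => _; first by rewrite /= gt_eqF.
    by rewrite abse0 poweR0r ?gt_eqF.
  by rewrite integral_cst// gt0_mulye// poweRyr// gt_eqF ?invr_gt0.
- move=> _; rewrite ifT; last first.
    by apply: lt_le_trans mTgt0 _; apply: le_measure; rewrite ?inE.
  apply/eqP; rewrite -leye_eq leNgt; apply/negP => lty.
  have [N [mN N0 subN]] := ess_sup_ge m (abse \o (fun r : MR => if (r0 <=
    r)%R then +oo else 0)).
  have : m T <= m N.
    apply: le_measure; rewrite ?inE// => r Tr; apply: subN => /=.
    have -> : (r0 <= r)%R by rewrite -TE mem_set.
    by rewrite /= leye_eq => /eqP E; rewrite E ltxx in lty.
  by rewrite N0 leNgt mTgt0.
Qed.

End tail.

Section weights.
Local Open Scope classical_set_scope.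
Local Open Scope ring_scope.
Context {R : realType}.

(** The least nondecreasing majorant of [Theta] on the positive half-line. *)
Definition running_sup (Theta : R -> R) (r : R) : R :=
  sup [set Theta s | s in [set s | 0 < s <= r]].

(** Both exponents of [Theta_star] are positive, and the smaller of them is the one
    that matters for dilations of ratio at least 1. *)
Lemma Theta_star_dilation (Theta : R -> R) : Theta_star Theta ->
  exists C e : R, [/\ 1 <= C, 0 < e & forall r a, 0 < r -> 1 <= a ->
    Theta r <= C * a `^ (- e) * Theta (a * r)].
Proof.
move=> [T0 [C [e1 [e2 [C0 /andP[e10 _] /andP[e20 _] HC]]]]].
exists (Num.max 1 C), (Num.min e1 e2); split.
- by rewrite le_max lexx.
- by rewrite lt_min e10.
move=> r a r0 a1; have a0 : 0 < a by apply: lt_le_trans a1.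
have ar0 : 0 < a * r by rewrite mulr_gt0.
have := HC (a * r) a^-1 ar0; rewrite invr_gt0 => /(_ a0).
rewrite mulKf ?gt_eqF// ler_pdivrMr ?T0// => /le_trans; apply.
rewrite ler_wpM2r ?(ltW (T0 _ ar0))//.
have aE e : a^-1 `^ e = a `^ (- e).
  by rewrite -powR_inv1 ?(ltW a0)// -powRrM mulN1r.
apply: ler_pM; rewrite ?(ltW C0)//.
- by rewrite le_max powR_ge0.
- by rewrite le_max lexx orbT.
- by rewrite !aE ge_max !ler_powR ?lerN2 ?ge_min ?lexx ?orbT.
Qed.

Variables (Theta : R -> R) (C : R).
Hypothesis T0 : forall r, 0 < r -> 0 < Theta r.
Hypothesis TC : forall s r, 0 < s -> s <= r -> Theta s <= C * Theta r.

Let img_ub (r : R) : 0 < r -> ubound [set Theta s | s in [set s | 0 < s <=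
  r]] (C * Theta r).
Proof. by move=> r0 _ [s /= /andP[s0 sr] <-]; exact: TC. Qed.

Lemma running_sup_le r : 0 < r -> running_sup Theta r <= C * Theta r.
Proof.
move=> r0; apply: ge_sup; last exact: img_ub.
by exists (Theta r), r => //=; rewrite r0 lexx.
Qed.

Lemma running_sup_ge r : 0 < r -> Theta r <= running_sup Theta r.
Proof.
move=> r0; apply: ub_le_sup; first by exists (C * Theta r); exact: img_ub.
by exists r => //=; rewrite r0 lexx.
Qed.

Lemma running_sup_ge0 r : 0 <= running_sup Theta r.
Proof.
have [r0|r0] := ltP 0 r; first exact: le_trans (ltW (T0 r0)) (running_sup_ge r0).
rewrite /running_sup (_ : [set _ | _ in _] =
  set0) ?sup0// -subset0 => _ [s /= /andP[s0 sr] _].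
by have := lt_le_trans s0 (le_trans sr r0); rewrite ltxx.
Qed.

Lemma nondecreasing_running_sup : nondecreasing_fun (running_sup Theta).
Proof.
move=> r s rs; have [r0|r0] := ltP 0 r; last first.
  rewrite {1}/running_sup (_ : [set _ | _ in _] = set0) ?sup0 ?running_sup_ge0//.
  rewrite -subset0 => _ [t /= /andP[t0 tr] _].
  by have := lt_le_trans t0 (le_trans tr r0); rewrite ltxx.
apply: ge_sup; first by exists (Theta r), r => //=; rewrite r0 lexx.
move=> _ [t /= /andP[t0 tr] <-]; apply: ub_le_sup.
  by exists (C * Theta s); apply: img_ub; exact: lt_le_trans rs.
by exists t => //=; rewrite t0 (le_trans tr).
Qed.

Lemma measurable_nondecreasing_ereal (N : measurableTypeR R -> \bar R) :
  (forall r s, r <= s -> (N r <= N s)%E) -> measurable_fun setT N.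
Proof.
move=> N_nd _; apply: (measurability _ (ErealGenOInfty.measurableE R)) => //.
move=> _ [_ [t ->] <-]; rewrite setTI; apply: is_interval_measurable => x y /=.
rewrite !in_itv/= !andbT => Nx Ny z /andP[xz _].
by rewrite in_itv/= andbT (lt_le_trans Nx)// N_nd.
Qed.

End weights.

Section weighted.
Local Open Scope classical_set_scope.
Local Open Scope ring_scope.
Local Open Scope ereal_scope.
Context {R : realType}.
Notation MR := (measurableTypeR R).

(** Up to a constant, the least [K] for which the growth hypothesis of the local
    estimate holds at [r].  The exponent [j.+1] is the upper end of the dyadic
    interval that contains [t]. *)
Definition dyadic_sup (mu dil : R) (N : R -> \bar R) (r : R) : \bar R :=
  ereal_sup (range (fun j => ((2 `^ mu) ^+ j)%:E * N (dil * 2 ^+ j.+1 * r)%R)).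

Lemma dyadic_bracket (t : R) : (1 <= t)%R -> exists j, (2 ^+ j <= t < 2 ^+ j.+1)%R.
Proof.
move=> t1; have t0 : (0 < t)%R by apply: lt_le_trans t1.
have ex : exists j, (t < 2 ^+ j)%R.
  exists (Num.bound t); apply: lt_le_trans (archi_boundP (ltW t0)) _.
  by rewrite -natrX ler_nat ltnW// ltn_expl.
have [[|j] tj minj] := ex_minnP ex; first by move: tj; rewrite expr0 ltNge t1.
exists j; rewrite tj andbT leNgt; apply/negP => /minj; by rewrite ltnn.
Qed.

Lemma growth_dyadic_sup (mu dil r h e : R) (N : R -> \bar R) : (mu < 0)%R ->
  (0 < dil)%R -> (0 < r)%R ->
  (forall r s, (r <= s)%R -> N r <= N s) -> (0 <= h)%R -> (0 < e)%R ->
  dyadic_sup mu dil N r <= h%:E ->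
  forall t, (1 <= t)%R -> N (dil * r * t)%R <= (t `^ (- mu) * (h + e))%:E.
Proof.
move=> mu0 d0 r0 Nnd h0 e0 Hh t t1.
have t0 : (0 < t)%R by apply: lt_le_trans t1.
have [j /andP[jt tj]] := dyadic_bracket t1.
have b0 : (0 < (2 `^ mu) ^+ j :> R)%R by rewrite exprn_gt0// powR_gt0.
apply: (@le_trans _ _ (N (dil * 2 ^+ j.+1 * r)%R)).
  by apply: Nnd; rewrite mulrAC ler_pM2r// ler_pM2l// ltW.
apply: (@le_trans _ _ (((2 `^ mu) ^+ j)^-1 * h)%:E).
  rewrite EFinM lee_pdivlMl//; apply: le_trans Hh.
  by apply: ereal_sup_ubound; exists j.
rewrite lee_fin; apply: ler_pM => //.
  by rewrite powR_exprn// -powRN; apply: ge0_ler_powR;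
    rewrite ?nnegrE ?exprn_ge0 ?oppr_ge0 ?(ltW mu0) ?(ltW t0).
by rewrite lerDl ltW.
Qed.

(** The supremum may vanish, whereas the estimate is available for positive [K]
    only; hence the approximation from above. *)
Lemma le_dyadic_sup (mu dil r C0 : R) (P : \bar R) (N : R -> \bar R) : (mu < 0)%R ->
  (0 < dil)%R -> (0 < r)%R ->
  (forall r s, (r <= s)%R -> N r <= N s) -> (0 < C0)%R ->
  (forall r, (0 < r)%R -> 0 <= N r) ->
  (forall K, (0 < K)%R -> (forall t, (1 <= t)%R ->
     N (dil * r * t)%R <= (t `^ (- mu) * K)%:E) -> P <= (C0 * K)%:E) ->
  P <= C0%:E * dyadic_sup mu dil N r.
Proof.
move=> mu0 d0 r0 Nnd C00 N0 HP.
have H0 : 0 <= dyadic_sup mu dil N r.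
  apply: (@le_trans _ _ (((2 `^ mu) ^+ 0)%R%:E * N (dil * 2 ^+ 1 * r)%R)).
    by rewrite expr0 mul1e N0// !mulr_gt0.
  by apply: ereal_sup_ubound; exists 0%N.
case E : (dyadic_sup mu dil N r) H0 => [h0||]// H0; last first.
  by rewrite gt0_muley ?lte_fin// leey.
rewrite lee_fin in H0.
rewrite -EFinM; apply/lee_addgt0Pr => e e0.
have eC0 : (0 < e / C0)%R by rewrite divr_gt0.
rewrite -EFinD (_ : (C0 * h0 + e = C0 * (h0 + e / C0))%R); last first.
  by rewrite mulrDr; congr (_ + _)%R; rewrite mulrC divfK ?gt_eqF.
apply: HP; first by rewrite ltr_wpDl.
by apply: growth_dyadic_sup => //; rewrite E.
Qed.

Variables (sigma tau mu dil : R) (Theta : R -> R).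
Hypotheses (tau0 : (0 < tau)%R) (mu0 : (mu < 0)%R) (sm : (sigma + mu <= 0)%R).
Hypothesis dil1 : (1 <= dil)%R.
Hypothesis hTheta : Theta_star Theta.

Let w (r : R) := (r `^ (- sigma) * Theta (r `^ tau))%R.

Let dil0 : (0 < dil)%R. Proof. exact: lt_le_trans dil1. Qed.

Let w_gt0 r : (0 < r)%R -> (0 < w r)%R.
Proof.
by move=> r0; rewrite mulr_gt0 ?powR_gt0//; apply: hTheta.1; exact: powR_gt0.
Qed.

(** The ratio is [rho = 2 ^ (sigma - tau e + mu)], where [e] is the exponent of
    [Theta]: it is less than 1 because [sigma + mu <= 0 < tau e]. *)
Lemma weight_dilation : exists rho c : R, [/\ (0 < rho < 1)%R, (0 < c)%R &
  forall r j, (0 < r)%R ->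
    (w r * (2 `^ mu) ^+ j <= c * rho ^+ j * w (dil * 2 ^+ j.+1 * r))%R].
Proof.
have [C [e [C1 e0 HC]]] := Theta_star_dilation hTheta.
have T0 := hTheta.1.
pose s := (sigma - tau * e)%R.
have te0 : (0 < tau * e)%R by rewrite mulr_gt0.
exists (2 `^ (s + mu))%R, (C * (2 * dil) `^ s)%R; split.
- rewrite powR_gt0//=.
  have smu : (s + mu < 0)%R by rewrite /s addrAC subr_lt0 (le_lt_trans sm).
  have : (1 < 2 `^ (- (s + mu)) :> R)%R by apply: powR2_gt1; rewrite oppr_gt0.
  by rewrite powRN invf_gt1 ?powR_gt0.
- by rewrite mulr_gt0 ?powR_gt0 ?mulr_gt0// (lt_le_trans _ C1).
move=> r j r0; set a := (dil * 2 ^+ j.+1)%R.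
have a1 : (1 <= a)%R by rewrite /a mulr_ege1// exprn_ege1// ler1n.
have a0 : (0 < a)%R by apply: lt_le_trans a1.
have at1 : (1 <= a `^ tau)%R by rewrite -(powRr0 a) ler_powR// ltW.
have := HC (r `^ tau)%R (a `^ tau)%R (powR_gt0 _ r0) at1.
rewrite -(powRM _ (ltW a0) (ltW r0)) => HT.
have rE : (r `^ (- sigma) = a `^ sigma * (a * r) `^ (- sigma))%R.
  rewrite (powRM _ (ltW a0) (ltW r0)) mulrA -powRD ?(gt_eqF a0) ?implybT//.
  by rewrite subrr powRr0 mul1r.
rewrite /w rE.
apply: (@le_trans _ _ (a `^ sigma * (a * r) `^ (- sigma) *
  (C * (a `^ tau) `^ (- e) * Theta ((a * r) `^ tau)) * (2 `^ mu) ^+ j)%R).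
  by rewrite ler_wpM2r ?exprn_ge0 ?powR_ge0// ler_wpM2l// mulr_ge0 ?powR_ge0.
have aE : (a `^ s = a `^ sigma * (a `^ tau) `^ (- e))%R.
  by rewrite -powRrM -powRD ?(gt_eqF a0) ?implybT// /s mulrN.
have aE2 : (a `^ s = (2 * dil) `^ s * (2 `^ s) ^+ j)%R.
  rewrite powR_exprn// -powRM ?exprn_ge0 ?mulr_ge0 ?(ltW dil0)//.
  by congr (_ `^ _)%R; rewrite /a exprS; ring.
have rhoE : (2 `^ (s + mu) = 2 `^ s * 2 `^ mu :> R)%R.
  by rewrite powRD// pnatr_eq0 implybT.
rewrite rhoE exprMn le_eqVlt; apply/orP; left; apply/eqP.
transitivity (C * (a `^ sigma * (a `^ tau) `^ (- e)) * (2 `^ mu) ^+ j *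
  ((a * r) `^ (- sigma) * Theta ((a * r) `^ tau)))%R; first by ring.
by rewrite -aE aE2; ring.
Qed.

Variable I : interval R.
Hypothesis Igt0 : forall r, r \in I -> (0 < r)%R.
Hypothesis Iup : forall r a, r \in I -> (1 <= a)%R -> (a * r)%R \in I.
Hypothesis I1 : forall r, (1 <= r)%R -> r \in I.
Notation m := (mrestr (@haar R) (measurable_itv I)).

(** Replace [Theta] by its least nondecreasing majorant, which is measurable and at
    most [C] times [Theta], and divide by [C]. *)
Lemma measurable_minorant : exists2 C : R, (0 < C)%R & forall N : R -> \bar R,
  (forall r s, (r <= s)%R -> N r <= N s) -> (forall r, (0 < r)%R -> 0 <= N r) ->
  exists G : MR -> \bar R, [/\ measurable_fun setT G, forall r, 0 <= G r &
    forall r, (0 < r)%R -> G r <= (w r)%:E * N r /\ (w r)%:E * N r <= C%:E * G r].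
Proof.
have [C [e [C1 e0 HC]]] := Theta_star_dilation hTheta.
have T0 := hTheta.1.
have C0 : (0 < C)%R by apply: lt_le_trans C1.
have TC s r : (0 < s)%R -> (s <= r)%R -> (Theta s <= C * Theta r)%R.
  move=> s0 sr; have r0 : (0 < r)%R by apply: lt_le_trans sr.
  have rs1 : (1 <= r / s)%R by rewrite ler_pdivlMr// mul1r.
  have := HC s (r / s)%R s0 rs1; rewrite divfK ?gt_eqF// => /le_trans; apply.
  rewrite ler_wpM2r ?(ltW (T0 _ r0))// -[leRHS]mulr1 ler_wpM2l ?(ltW C0)//.
  by rewrite -(powRr0 (r / s)) ler_powR// oppr_le0 ltW.
exists C => // N Nnd N0.
pose D : set MR := `]0%R, +oo[%classic.
have mD : measurable D by exact: measurable_itv.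
have DE (r : MR) : (r \in D) = (0 < r)%R.
  by apply/idP/idP; rewrite inE /D/= in_itv/= andbT.
pose v (r : MR) := (C^-1 * (r `^ (- sigma) * running_sup Theta (r `^ tau)))%R.
exists ((fun r => (v r)%:E * N r) \_ D); split.
- apply/(measurable_restrictT _ _).1 => //; apply: measurable_funTS.
  apply: emeasurable_funM; last exact: measurable_nondecreasing_ereal.
  apply/measurable_EFinP; apply: measurable_funM => //; apply: measurable_funM.
    exact: measurable_powR.
  apply: (@measurableT_comp _ _ _ _ _ _ (running_sup Theta)); last exact: measurable_powR.
  apply: nondecreasing_measurable => //.
  exact: (nondecreasing_running_sup T0 TC).
- move=> r; rewrite patchE DE; case: ifP => // r0; apply: mule_ge0; last exact: N0.
  rewrite lee_fin mulr_ge0 ?invr_ge0 ?(ltW C0)// mulr_ge0 ?powR_ge0//.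
  exact: (running_sup_ge0 T0 TC).
move=> r r0; rewrite patchE DE r0; have rt0 : (0 < r `^ tau)%R by rewrite powR_gt0.
split.
- apply: lee_wpmul2r; first exact: N0.
  rewrite lee_fin /v ler_pdivrMl// mulrCA ler_wpM2l ?powR_ge0//.
  exact: (running_sup_le TC).
rewrite muleA -EFinM /v mulrA divff ?gt_eqF// mul1r.
apply: lee_wpmul2r; first exact: N0.
rewrite lee_fin ler_wpM2l ?powR_ge0//.
exact: (running_sup_ge TC).
Qed.

(** [P] stands for the norm of [M_alpha f] on [Q_r].  Its finiteness for every [r],
    not just almost every [r], holds because [dyadic_sup] is nondecreasing: were it
    infinite at one [r], the norm of [w N] would be infinite. *)
Lemma weighted_transfer (u : \bar R) (C0 : R) : 0 < u -> (0 < C0)%R ->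
  exists2 C : R, (0 < C)%R & forall N P : R -> \bar R,
    (forall r s, (r <= s)%R -> N r <= N s) -> (forall r, (0 < r)%R -> 0 <= N r) ->
    (forall r, (0 < r)%R -> 0 <= P r) ->
    (forall r K, (0 < r)%R -> (0 < K)%R ->
      (forall t, (1 <= t)%R -> N (dil * r * t)%R <= (t `^ (- mu) * K)%:E) ->
      P r <= (C0 * K)%:E) ->
    Lnorm m u (fun r => (w r)%:E * N r) < +oo ->
    (forall r, (0 < r)%R -> P r < +oo) /\
    Lnorm m u (fun r => (w r)%:E * P r) <= C%:E * Lnorm m u (fun r => (w r)%:E * N r).
Proof.
move=> u0 C00.
have [rho [c [rho01 c0 Hw]]] := weight_dilation.
have [C1 C10 HG] := measurable_minorant.
have cc0 : (0 < C0 * (c * C1))%R by rewrite !mulr_gt0.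
have [C C_gt0 HC] := Lnorm_dilation_sup Iup u0 rho01 cc0.
exists C => // N P Nnd N0 P0 HP fin.
have [G [mG G0 GN]] := HG N Nnd N0.
pose a j := (dil * 2 ^+ j.+1)%R.
have a1 j : (1 <= a j)%R by rewrite /a mulr_ege1// exprn_ege1// ler1n.
pose S r := ereal_sup (range (fun j => (rho ^+ j)%:E * G (a j * r)%R)).
have wH r : (0 < r)%R -> (w r)%:E * dyadic_sup mu dil N r <= (c * C1)%:E * S r.
  move=> r0; have wr0 := w_gt0 r0.
  rewrite -lee_pdivlMl//; apply: ge_ereal_sup => _ [j _ <-].
  rewrite lee_pdivlMl// muleA -EFinM.
  have ar0 : (0 < a j * r)%R by rewrite mulr_gt0// (lt_le_trans _ (a1 j)).
  have rj0 : (0 <= rho ^+ j)%R by rewrite exprn_ge0//; case/andP: rho01 => /ltW.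
  apply: (@le_trans _ _ ((c * rho ^+ j * w (a j * r))%:E * N (a j * r)%R)).
    by apply: lee_wpmul2r; [exact: N0|rewrite lee_fin; exact: Hw].
  apply: (@le_trans _ _ ((c * C1)%:E * ((rho ^+ j)%:E * G (a j * r)%R))); last first.
    apply: lee_wpmul2l; first by rewrite lee_fin mulr_ge0 ?ltW.
    by apply: ereal_sup_ubound; exists j.
  rewrite (EFinM (c * rho ^+ j)%R) -muleA.
  have -> : (c * C1)%:E * ((rho ^+ j)%:E * G (a j * r)%R) =
      (c * rho ^+ j)%:E * (C1%:E * G (a j * r)%R).
    by rewrite !muleA -!EFinM; congr (_%:E * _); ring.
  apply: lee_wpmul2l; first by rewrite lee_fin mulr_ge0 ?(ltW c0).
  by have [] := GN _ ar0.
have GN_norm : Lnorm m u G <= Lnorm m u (fun r => (w r)%:E * N r).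
  apply: le_Lnorm_haar => // r Ir.
  have r0 := Igt0 Ir; have [GwN _] := GN r r0.
  by rewrite !gee0_abs// mule_ge0 ?N0// lee_fin ltW ?w_gt0.
have Hsup r : (0 < r)%R -> dyadic_sup mu dil N r < +oo.
  move=> r0; rewrite ltNge leye_eq; apply/negP => /eqP Hoo.
  have := HC a G (fun r' => if (r <= r')%R then +oo else 0) a1 mG G0.
  rewrite (Lnorm_tail_infty I1 r u0) leye_eq => H.
  have : C%:E * Lnorm m u G < +oo.
    by apply: lte_mul_pinfty; rewrite ?lee_fin ?(ltW C_gt0)//;
      exact: le_lt_trans GN_norm fin.
  rewrite lt_neqAle => /andP[/negP + _]; apply; apply: H => s Is.
  have s0 := Igt0 Is; case: ifP => rs; last first.
    rewrite abse0; apply: mule_ge0; first by rewrite lee_fin ltW.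
    apply: (@le_trans _ _ ((rho ^+ 0)%:E * G (a 0%N * s)%R)); last first.
      by apply: ereal_sup_ubound; exists 0%N.
    by rewrite expr0 mul1e.
  have soo : dyadic_sup mu dil N s = +oo.
    apply/eqP; rewrite -leye_eq -Hoo; apply: ge_ereal_sup => _ [j _ <-].
    apply: le_trans (ereal_sup_ubound _); last by exists j.
    apply: lee_wpmul2l; first by rewrite lee_fin exprn_ge0 ?powR_ge0.
    by apply: Nnd; rewrite ler_wpM2l// mulr_ge0 ?exprn_ge0 ?(ltW dil0).
  have := wH s s0; rewrite soo gt0_muley ?lte_fin ?w_gt0// leye_eq => /eqP E.
  by rewrite (EFinM C0) -muleA -/(S s) E gt0_muley ?lte_fin// leey.
have PH r : (0 < r)%R -> P r <= C0%:E * dyadic_sup mu dil N r.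
  by move=> r0; apply: le_dyadic_sup => // K K0; exact: HP.
split.
  move=> r r0; apply: le_lt_trans (PH r r0) _.
  apply: lte_mul_pinfty; rewrite ?lee_fin ?(ltW C00)//; exact: Hsup.
apply: (@le_trans _ _ (C%:E * Lnorm m u G)); last first.
  by apply: lee_wpmul2l => //; rewrite lee_fin ltW.
apply: (HC a) => // r Ir; have r0 := Igt0 Ir.
rewrite gee0_abs; last by apply: mule_ge0; [rewrite lee_fin ltW ?w_gt0|exact: P0].
rewrite (EFinM C0 (c * C1)%R) -muleA.
apply: (@le_trans _ _ (C0%:E * ((w r)%:E * dyadic_sup mu dil N r))).
  by rewrite (muleCA C0%:E); apply: lee_wpmul2l; [rewrite lee_fin ltW ?w_gt0|exact: PH].
by apply: lee_wpmul2l; [rewrite lee_fin ltW|exact: wH].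
Qed.

End weighted.

(** * Boundedness on the spaces B_w *)

Section morrey_monotone.
Local Open Scope classical_set_scope.
Local Open Scope ring_scope.
Local Open Scope ereal_scope.
Context {R : realType} {n : nat}.
Implicit Types f : Rn R n -> \bar R.

Lemma le_morrey_norm k p lam (U V : set 'rV[R]_n) f : U `<=` V ->
  morrey_norm k p lam U f <= morrey_norm k p lam V f.
Proof.
move=> UV; apply: ge_ereal_sup => _ [x [s [s0 sU ->]]]; apply: ereal_sup_ubound.
by exists x, s; split => //; exact: subset_trans sU UV.
Qed.

Lemma morrey_norm_ge0 k p lam (r : R) f : (0 < r)%R ->
  0 <= morrey_norm k p lam (Q0 k r) f.
Proof.
move=> r0; set z := ((r `^ lam)^-1)%R%:E *
  ((\int[lebesgue R n]_(y in Q k 0%R r) (`|f y| `^ p)) / lebesgue R n (Q k 0%R r)) `^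
    p^-1.
apply: (@le_trans _ _ z).
  by apply: mule_ge0; rewrite ?poweR_ge0// lee_fin invr_ge0 powR_ge0.
by apply: ereal_sup_ubound; exists 0%R, r; split => //; rewrite -Q0E.
Qed.

Lemma weak_morrey_norm_ge0 k p lam (r : R) f : (0 < r)%R ->
  0 <= weak_morrey_norm k p lam (Q0 k r) f.
Proof.
move=> r0; set z := ((r `^ lam)^-1)%R%:E * (ereal_sup [set (t `^ p)%R%:E *
    lebesgue R n (Q k 0%R r `&` [set y | t%:E < `|f y|]) | t in [set t : R | (0 < t)%R]]
   / lebesgue R n (Q k 0%R r)) `^ p^-1.
apply: (@le_trans _ _ z).
  by apply: mule_ge0; rewrite ?poweR_ge0// lee_fin invr_ge0 powR_ge0.
by apply: ereal_sup_ubound; exists 0%R, r; split => //; rewrite -Q0E.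
Qed.

Lemma bounded_operator_BI (I : interval R) k k' (alpha p lam mu sigma tau : R) (Theta :
  R -> R)
    (u : \bar R) (E : set 'rV[R]_n -> (Rn R n -> \bar R) -> \bar R) :
  (forall r, r \in I -> 0 < r)%R ->
  (forall r a, r \in I -> 1 <= a -> a * r \in I)%R ->
  (forall r, 1 <= r -> r \in I)%R ->
  (0 < n)%N -> 0 < u -> (0 < tau)%R -> (mu < 0)%R -> (sigma + mu <= 0)%R ->
  Theta_star Theta ->
  (forall (r : R) f, (0 < r)%R -> 0 <= E (Q0 k r) f) ->
  (exists2 C : R, (0 < C)%R & forall f (K r : R), measurable_fun setT f ->
     (0 < K)%R -> morrey_growth k p lam mu f K r ->
     E (Q0 k r) (frac_maximal k' alpha f) <= (C * K)%:E) ->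
  let w := fun r : R => (r `^ (- sigma) * Theta (r `^ tau))%R in
  let L := @morrey_norm R n k p lam in
  bounded_operator (frac_maximal k' alpha)
    (BI_space I k w u L) (BI_norm I k w u L)
    (BI_space I k w u E) (BI_norm I k w u E).
Proof.
move=> Igt0 Iup I1 n0 u0 tau0 mu0 sm hTheta E0 [C0 C00 HC0] w L.
have n1 : (1 <= n%:R :> R)%R by rewrite ler1n.
have dil1 : (1 <= 4 * n%:R ^+ 2 :> R)%R.
  by rewrite mulr_ege1 ?exprn_ege1// (ler_nat R 1 4).
have [C C_gt0 HC] := weighted_transfer tau0 mu0 sm dil1 hTheta Igt0 Iup I1 u0 C00.
exists C; split => // f [mf ffin fnorm].
have Nnd r s : (r <= s)%R -> L (Q0 k r) f <= L (Q0 k s) f.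
  by move=> rs; apply: le_morrey_norm; exact: Q0_mono.
have N0 r : (0 < r)%R -> 0 <= L (Q0 k r) f by exact: morrey_norm_ge0.
have [fin bound] := HC (fun r => L (Q0 k r) f)
  (fun r => E (Q0 k r) (frac_maximal k' alpha f)) Nnd N0
  (fun r => E0 r _) (fun r K _ => HC0 f K r mf) fnorm.
split; last exact: bound.
split; [exact: measurable_frac_maximal|exact: fin|].
apply: le_lt_trans bound _; apply: lte_mul_pinfty => //.
by rewrite lee_fin ltW.
Qed.

End morrey_monotone.

Local Open Scope ring_scope.

Theorem theorem5p2 (R : realType) (n : nat) (k k' : cube_or_ball)
  (alpha p q lam mu : R) (u : \bar R) (Theta : R -> R) (sigma tau : R)
  (halpha : 0 <= alpha < n%:R)
  (hp : 1 <= p) (hq : 1 <= q)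
  (hlam : - (n%:R / p) <= lam < 0) (hmu : - (n%:R / q) <= mu < 0)
  (hu : (0 < u)%E)
  (hTheta : Theta_star Theta)
  (hsigma : 0 < sigma) (htau : 0 < tau) (hst : tau < sigma)
  (hmulam : mu = lam + alpha)
  (hqp : q <= (lam / mu) * p)
  (hsla : sigma + lam + alpha <= 0) :
  let w := fun r : R => r `^ (- sigma) * Theta (r `^ tau) in
  let L := @morrey_norm R n k in
  let WL := @weak_morrey_norm R n k in
  let M := @frac_maximal R n k' alpha in
  ((1 < p -> bounded_operator M
               (B_space k w u (L p lam)) (B_norm k w u (L p lam))
               (B_space k w u (L q mu)) (B_norm k w u (L q mu))) /\
   (p = 1 -> bounded_operator M
               (B_space k w u (L 1 lam)) (B_norm k w u (L 1 lam))
               (B_space k w u (WL q mu)) (B_norm k w u (WL q mu)))) /\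
  ((1 < p -> bounded_operator M
               (Bdot_space k w u (L p lam)) (Bdot_norm k w u (L p lam))
               (Bdot_space k w u (L q mu)) (Bdot_norm k w u (L q mu))) /\
   (p = 1 -> bounded_operator M
               (Bdot_space k w u (L 1 lam)) (Bdot_norm k w u (L 1 lam))
               (Bdot_space k w u (WL q mu)) (Bdot_norm k w u (WL q mu)))).
Proof.
move=> w L WL M.
case/andP: halpha => alpha0 alphan; case/andP: hlam => _ lam0; case/andP: hmu => _ mu0.
have n0 : (0 < n)%N by rewrite -(ltr_nat R) (le_lt_trans alpha0).
have sm : sigma + mu <= 0 by rewrite hmulam addrA.
have strong : 1 < p -> exists2 C : R, 0 < C &
    forall (f : Rn R n -> \bar R) (K r : R), measurable_fun setT f ->
    0 < K -> morrey_growth k p lam mu f K r ->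
    (L q mu (Q0 k r) (frac_maximal k' alpha f) <= (C * K)%:E)%E.
  by move=> p1; exact: morrey_frac_maximal.
have weak : p = 1 -> exists2 C : R, 0 < C &
    forall (f : Rn R n -> \bar R) (K r : R), measurable_fun setT f ->
    0 < K -> morrey_growth k 1 lam mu f K r ->
    (WL q mu (Q0 k r) (frac_maximal k' alpha f) <= (C * K)%:E)%E.
  move=> p1; rewrite -p1; exact: weak_morrey_frac_maximal.
have main (I : interval R) :
    (forall r, r \in I -> 0 < r) -> (forall r a, r \in I -> 1 <= a -> a * r \in I) ->
    (forall r, 1 <= r -> r \in I) ->
    (1 < p -> bounded_operator M
       (BI_space I k w u (L p lam)) (BI_norm I k w u (L p lam))
       (BI_space I k w u (L q mu)) (BI_norm I k w u (L q mu))) /\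
    (p = 1 -> bounded_operator M
       (BI_space I k w u (L 1 lam)) (BI_norm I k w u (L 1 lam))
       (BI_space I k w u (WL q mu)) (BI_norm I k w u (WL q mu))).
  move=> Igt0 Iup I1; split => p1.
    apply: (bounded_operator_BI (mu := mu)) => //; last exact: strong.
    by move=> r f; exact: morrey_norm_ge0.
  apply: (bounded_operator_BI (mu := mu)) => //; last exact: weak.
  by move=> r f; exact: weak_morrey_norm_ge0.
split; apply: main => r; rewrite ?in_itv/= ?andbT.
- exact: lt_le_trans.
- by move=> a r1 a1; rewrite in_itv/= andbT mulr_ege1.
- by [].
- by [].
- by move=> a r0 a1; rewrite in_itv/= andbT mulr_gt0// (lt_le_trans _ a1).
- exact: lt_le_trans.
Qed.
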